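(* Let $J=[0,T]$ with $T>0$, let $0<\alpha<1$, let $f\in C(J\times\mathbb{R},\mathbb{R}\setminus\{0\})$ and $g\in C(J\times\mathbb{R},\mathbb{R})$, and suppose that for each $\tau\in J$ the map $x\mapsto \dfrac{x}{f(\tau,x)}$ is strictly increasing on $\mathbb{R}$. Let $v,w\in C(J)$ be such that the functions $\tau\mapsto \dfrac{v(\tau)}{f(\tau,v(\tau))}$ and $\tau\mapsto\dfrac{w(\tau)}{f(\tau,w(\tau))}$ have ABC-derivatives of order $\alpha$ belonging to $C(J)$, and suppose that (i) ${}^{ABC}{}_0\mathcal{D}^\alpha_\tau\left[\dfrac{v(\tau)}{f(\tau,v(\tau))}\right]\le g(\tau,v(\tau))$ for a.e. $\tau\in J$, (ii) ${}^{ABC}{}_0\mathcal{D}^\alpha_\tau\left[\dfrac{w(\tau)}{f(\tau,w(\tau))}\right]\ge g(\tau,w(\tau))$ for a.e. $\tau\in J$. Suppose further that there is a constant $L$ with $0<L<\dfrac{B(\alpha)}{1-\alpha}$ such that $$ g(\tau,x)-g(\tau,y)\le L\left(\frac{x}{f(\tau,x)}-\frac{y}{f(\tau,y)}\right)\quad\text{for all }\tau\in J\text{ and all }x,y\in\mathbb{R}\text{ with }x\ge y. $$ If $v(0)\le w(0)$, then $v(\tau)\le w(\tau)$ for all $\tau\in J$.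
   Context: $B$ is a fixed normalization function on $[0,1]$ with $B(\alpha)>0$ and $B(0)=B(1)=1$. $\mathbb{E}_\alpha(z)=\sum_{n=0}^\infty \frac{z^n}{\Gamma(n\alpha+1)}$ is the one-parameter Mittag-Leffler function. For $x\in H^1(0,T)$ the left Atangana--Baleanu--Caputo (ABC) fractional derivative of order $\alpha$ is $$ {}^{ABC}{}_0\mathcal{D}^\alpha_\tau x(\tau)=\frac{B(\alpha)}{1-\alpha}\int_0^\tau \mathbb{E}_\alpha\left[-\frac{\alpha}{1-\alpha}(\tau-\sigma)^\alpha\right]x'(\sigma)\,d\sigma ; $$ saying that $x$ has an ABC-derivative means $x\in H^1(0,T)$. *)

(* Defs.v *)
From HB Require Import structures.
From mathcomp Require Import all_boot all_order all_algebra.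
From mathcomp Require Import all_classical all_reals all_analysis.

Set Implicit Arguments.
Unset Strict Implicit.
Unset Printing Implicit Defensive.
Import Order.TTheory GRing.Theory Num.Theory.
Import numFieldNormedType.Exports.
Local Open Scope classical_set_scope.
Local Open Scope ring_scope.

(* Euler's integral; meaningful for [0 < z]. *)
Definition Gamma (R : realType) (z : R) : R :=
  \int[lebesgue_measure]_(x in `]0, +oo[) (x `^ (z - 1) * expR (- x)).

Definition mittag_leffler (R : realType) (alpha z : R) : R :=
  limn (series (fun n : nat => z ^+ n / Gamma (n%:R * alpha + 1))).

Definition is_normalization (R : realType) (B : R -> R) : Prop :=
  [/\ forall a, a \in `[0, 1] -> 0 < B a, B 0 = 1 & B 1 = 1].

(* [L^2(0, T)]; values outside the open interval are irrelevant, hence the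
   extension by zero. *)
Definition L2 (R : realType) (T : R) (u : R -> R) : Prop :=
  u \_ `]0, T[ \in Lfun lebesgue_measure 2%:E.

(* [C^1_c(0, T)], each function being extended by zero to the real line. *)
Definition is_test_function (R : realType) (T : R) (phi : R -> R) : Prop :=
  [/\ forall t, derivable phi t 1,
      continuous (derive1 phi) &
      exists K : set R, [/\ compact K, K `<=` `]0, T[ &
        forall t, ~ K t -> phi t = 0]].

Definition is_weak_derivative (R : realType) (T : R) (x u : R -> R) : Prop :=
  forall phi : R -> R, is_test_function T phi ->
    \int[lebesgue_measure]_(t in `]0, T[) (x t * derive1 phi t) =
    - \int[lebesgue_measure]_(t in `]0, T[) (u t * phi t).

(* The Sobolev space [H^1(0, T) = W^{1,2}(0, T)]. *)
Definition H1 (R : realType) (T : R) (x : R -> R) : Prop :=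
  L2 T x /\ exists u, L2 T u /\ is_weak_derivative T x u.

(* A representative of the weak derivative, which is unique almost everywhere
   on [(0, T)]; the zero function when there is none. *)
Definition weak_derivative (R : realType) (T : R) (x : R -> R) : R -> R :=
  xget (fun=> 0) [set u | L2 T u /\ is_weak_derivative T x u].

(* Left ABC derivative at [tau], for [x] in [H1 T] and [tau] in [[0, T]]. *)
Definition ABC (R : realType) (B : R -> R) (alpha T : R) (x : R -> R)
    (tau : R) : R :=
  B alpha / (1 - alpha) *
  \int[lebesgue_measure]_(s in `[0, tau])
    (mittag_leffler alpha (- (alpha / (1 - alpha)) * (tau - s) `^ alpha) *
     weak_derivative T x s).

(* Main.v *)
Require Import Defs.
From HB Require Import structures.
From mathcomp Require Import all_boot all_order all_algebra.
From mathcomp Require Import all_classical all_reals all_analysis.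
From mathcomp Require Import measurable_realfun ring lra.

Set Implicit Arguments.
Unset Strict Implicit.
Unset Printing Implicit Defensive.
Import Order.TTheory GRing.Theory Num.Theory.
Import numFieldNormedType.Exports.
Local Open Scope classical_set_scope.
Local Open Scope ring_scope.

(** Write [x = v/f(.,v)], [y = w/f(.,w)], [z = x - y] and
    [c = B alpha / (1 - alpha)].  Monotonicity of [u |-> u / f t u] turns the
    claim into [z <= 0].  The kernel of the ABC derivative at [tau] is
    [K s = E_alpha(-la (tau - s)^alpha)] with [la = alpha / (1 - alpha)].  It is
    nondecreasing in [s] with values in [[0, 1]], and [K tau = 1].  Suppose that
    [z <= 0] on [[0, a]] and that [z] has a positive maximum [M] over
    [[0, tau]] at [tau].  As [K] is a superposition of indicators of intervals
    that end at [tau], and as [z'] integrates over [[s, tau]] to [M - z s],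
    which is nonnegative, and at least [M] when [s <= a], one gets
    [\int_0^tau K z' >= K a * M] ([Rintegral_nondecreasing_ge],
    [ABC_sub_ge]).  The differential inequalities and the Lipschitz condition
    bound the left-hand side, times [c], by [L * M].  Hence [c * K a <= L],
    which is impossible when [tau - a] is so small that [K a > L / c].  The
    interval where [z <= 0] can therefore be extended by a fixed length
    [delta], and finitely many extensions reach [T].

    Three facts have to be supplied.

    The function [x |-> E_alpha(-x)] is nonnegative and nonincreasing on
    [[0, +oo[], and continuous at [0].  This is obtained by discretising the
    fractional equation [D^alpha u = - la u]: the numbers [u_n(mu)] with
    generating function
    [\sum_n u_n z^n = (1 - z)^(alpha - 1) / ((1 - z)^alpha + mu)] satisfy a
    recursion with nonnegative coefficients, which gives both their sign and
    their monotonicity in [mu] ([ml_approx_ge0], [ml_approx_nonincreasing]).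
    Expanding in powers of [mu], [u_n(x / n^alpha)] is a series whose terms
    converge to those of [E_alpha(-x)] and admit a uniform geometric bound, so
    that Tannery's theorem gives the limit ([cvg_ml_approx]).

    The convergence of the terms is Gauss's limit
    [(b + 1)...(b + n) / (n! n^b) --> 1 / Gamma (b + 1)] ([gauss_Gamma]).  It
    comes from the integrals of [(1 - x / n)^n x^b] over [[0, n]], which are
    explicit and tend to Euler's integral by dominated convergence.

    Finally, a continuous function with an integrable weak derivative is the
    integral of that derivative up to the endpoints ([weak_derivative_FTC]):
    one tests against plateau functions that converge to the indicator of
    [[s, t]]. *)

(** * Series dominated by a geometric series *)

Lemma cvg_series_dom (R : realType) (a : R^nat) (C : R) :
  (forall k, `|a k| <= C / 2 ^+ k) -> cvgn (series a).
Proof.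
move=> aC; apply: normed_cvg; apply: (series_le_cvg (v_ := geometric C 2^-1)).
- by move=> n /=.
- move=> n /=; rewrite exprVn; exact: le_trans (normr_ge0 (a n)) (aC n).
- by move=> n /=; rewrite exprVn.
- by apply: is_cvg_geometric_series; rewrite ger0_norm ?invf_lt1 ?ltr1n.
Qed.

Lemma series_tail_dom (R : realType) (a : R^nat) (C : R) m n :
  (forall k, `|a k| <= C / 2 ^+ k) -> (m <= n)%N ->
  `|series a n - series a m| <= 2 * C / 2 ^+ m.
Proof.
move=> aC mn; have C0 : 0 <= C.
  by have := le_trans (normr_ge0 _) (aC 0%N); rewrite expr0 divr1.
rewrite sub_series mn; apply: le_trans (ler_norm_sum _ _ _) _.
apply: (@le_trans _ _ (2 * C / 2 ^+ m - 2 * C / 2 ^+ n)); last first.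
  by rewrite gerBl divr_ge0// mulr_ge0.
elim: n mn => [|n IH].
  by rewrite leqn0 => /eqP ->; rewrite big_geq// subrr.
rewrite leq_eqVlt => /predU1P[<-|]; first by rewrite big_geq// subrr.
rewrite ltnS => mn; rewrite big_nat_recr//=.
apply: le_trans (lerD (IH mn) (aC n)) _.
by rewrite exprS le_eqVlt; apply/orP; left; apply/eqP; field; rewrite !expf_neq0//.
Qed.

Lemma lim_series_tail_dom (R : realType) (a : R^nat) (C : R) m :
  (forall k, `|a k| <= C / 2 ^+ k) ->
  `|limn (series a) - series a m| <= 2 * C / 2 ^+ m.
Proof.
move=> aC; have ca := cvg_series_dom aC.
have cv : (fun n => `|series a n - series a m|) @ \oo -->
   `|limn (series a) - series a m|.
  by apply: cvg_norm; apply: cvgB => //; exact: cvg_cst.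
apply: (cvgr_to_le cv).
by exists m => // n /= mn; exact: series_tail_dom.
Qed.

(** Past index [K] all the series differ from their partial sums by the same
    small amount, and a partial sum converges term by term. *)
Lemma cvg_series_tannery (R : realType) (a : nat -> R^nat) (b : R^nat) (C : R) :
  (forall k, (fun n => a n k) @ \oo --> b k) ->
  (\forall n \near \oo, forall k, `|a n k| <= C / 2 ^+ k) ->
  (fun n => limn (series (a n))) @ \oo --> limn (series b).
Proof.
move=> ab aC.
have bC k : `|b k| <= C / 2 ^+ k.
  apply: (cvgr_to_le (cvg_norm (ab k))).
  by apply: filterS aC => n; exact.
have C0 : 0 <= C.
  by have := le_trans (normr_ge0 _) (bC 0%N); rewrite expr0 divr1.
apply/cvgrPdist_le => e e0.
have [K HK] : exists K, 2 * C / 2 ^+ K <= e / 3.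
  have : (fun n => geometric (2 * C) 2^-1 n) @ \oo --> (0 : R).
    by apply: cvg_geometric; rewrite ger0_norm ?invf_lt1 ?ltr1n.
  move=> /cvgrPdist_le /(_ (e / 3)) []; first by rewrite divr_gt0.
  move=> K _ /(_ K (leqnn K)); rewrite /= sub0r normrN ger0_norm => [h|].
    by exists K; rewrite -exprVn.
  by rewrite mulr_ge0// mulr_ge0.
have cK : (fun n => series (a n) K) @ \oo --> series b K.
  elim: {HK} K => [|K IH].
    have s0 (u : R^nat) : series u 0%N = 0 by rewrite /series/= big_geq.
    by under eq_fun do rewrite s0; rewrite s0; exact: cvg_cst.
  under eq_fun do rewrite seriesSr.
  by rewrite seriesSr; apply: cvgD.
have e3 : 0 < e / 3 by rewrite divr_gt0.
have /cvgrPdist_le /(_ _ e3) near1 := cK.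
near=> n.
have h1 : `|series b K - series (a n) K| <= e / 3 by near: n.
have aCn : forall k, `|a n k| <= C / 2 ^+ k by near: n.
have h2 := le_trans (lim_series_tail_dom K aCn) HK.
have h3 := le_trans (lim_series_tail_dom K bC) HK.
move: h1 h2 h3; rewrite !ler_norml => /andP[? ?] /andP[? ?] /andP[? ?].
by apply/andP; split; lra.
Unshelve. all: by end_near. Qed.

(** * Coefficients of real powers of 1 - z *)

(** The coefficient of [z ^+ n] in the power series [(1 - z) `^ (- b)]. *)
Definition nbin (R : realType) (b : R) (n : nat) : R :=
  \prod_(j < n) ((b + j%:R) / j.+1%:R).

Lemma nbin0 (R : realType) (b : R) : nbin b 0 = 1.
Proof. by rewrite /nbin big_ord0. Qed.

Lemma nbinS (R : realType) (b : R) n :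
  nbin b n.+1 = nbin b n * ((b + n%:R) / n.+1%:R).
Proof. by rewrite /nbin big_ord_recr. Qed.

Lemma nbinSM (R : realType) (b : R) n :
  n.+1%:R * nbin b n.+1 = (b + n%:R) * nbin b n.
Proof. by rewrite nbinS; field; rewrite addrC natr1 pnatr_eq0. Qed.

Lemma nbin_ge0 (R : realType) (b : R) n : 0 <= b -> 0 <= nbin b n.
Proof.
by move=> b0; apply: prodr_ge0 => j _; rewrite divr_ge0// addr_ge0.
Qed.

Lemma nbin_le0 (R : realType) (b : R) n : -1 <= b <= 0 -> (0 < n)%N ->
  nbin b n <= 0.
Proof.
move=> /andP[b1 b0]; case: n => // n _.
elim: n => [|n IH]; first by rewrite nbinS nbin0 addr0 mul1r divr1.
rewrite nbinS mulr_le0_ge0// divr_ge0//.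
by rewrite -natr1; have := ler0n R n; lra.
Qed.

Lemma nbin_nondecreasing (R : realType) (b : R) : 0 <= b ->
  {homo nbin (b + 1) : m n / (m <= n)%N >-> m <= n}.
Proof.
move=> b0; apply: homo_leq => // [? ? ? |n]; first exact: le_trans.
rewrite nbinS ler_peMr// ?nbin_ge0 ?addr_ge0//.
rewrite ler_pdivlMr// mul1r -natr1; have := ler0n R n; lra.
Qed.

(** This compares coefficients in
    [(1 - z)^(- b) * (1 - z)^(- c) = (1 - z)^(- (b + c))].  Multiplying by [n]
    and splitting [n = i + (n - i)] reproduces the recursion of [nbin (b + c)]. *)
Lemma nbin_vandermonde (R : realType) (b c : R) n :
  \sum_(i < n.+1) nbin b i * nbin c (n - i) = nbin (b + c) n.
Proof.
elim: n => [|n IH]; first by rewrite big_ord1 !nbin0 mulr1.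
apply: (@mulfI _ n.+1%:R); first by rewrite pnatr_eq0.
rewrite nbinSM -IH !mulr_sumr.
transitivity (\sum_(i < n.+2) (i%:R * nbin b i) * nbin c (n.+1 - i) +
   \sum_(i < n.+2) nbin b i * ((n.+1 - i)%:R * nbin c (n.+1 - i))).
  rewrite -big_split; apply: eq_bigr => i _ /=.
  by rewrite natrB -1?ltnS//; ring.
rewrite big_ord_recl mul0r mul0r add0r [X in _ + X]big_ord_recr/=.
rewrite subnn mul0r mulr0 addr0 -big_split; apply: eq_bigr => i _ /=.
rewrite /bump /= add1n subSS subSn -1?ltnS// !nbinSM natrB -1?ltnS//.
by ring.
Qed.

(** The factors [1 + b / j] with [j > J] are at most [(j / (j - 1)) `^ b] and
    telescope; the first [J] ones are bounded crudely.  The point is the factor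
    [J%:R `^ (- b)], which beats any exponential in [b] once [J] is large. *)
Lemma nbin_le_powR (R : realType) (b : R) J n : 0 <= b -> (0 < J <= n)%N ->
  nbin (b + 1) n <= J%:R ^+ J * (expR 1 / J%:R) `^ b * n%:R `^ b.
Proof.
move=> b0 /andP[J0 Jn].
have JR : 0 < J%:R :> R by rewrite ltr0n.
elim: n Jn => [|n IH]; first by rewrite leqn0 => /eqP J0'; rewrite J0' in J0.
rewrite leq_eqVlt => /predU1P[<-{n IH}|].
  rewrite -mulrA -powRM ?divr_ge0 ?expR_ge0 ?(ltW JR)// divfK ?gt_eqF//.
  rewrite -expRM mul1r.
  apply: (@le_trans _ _ ((1 + b) ^+ J)).
    rewrite /nbin -[in leRHS](card_ord J) -prodr_const.
    apply: ler_prod => j _; apply/andP; split.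
      by rewrite divr_ge0// !addr_ge0.
    rewrite ler_pdivrMr ?ltr0Sn// -natr1 -subr_ge0.
    have -> : (1 + b) * (j%:R + 1) - (b + 1 + j%:R) = b * j%:R by ring.
    by rewrite mulr_ge0.
  have -> : expR b = expR (b / J%:R) ^+ J.
    by rewrite -expRM_natr divfK// gt_eqF.
  rewrite -exprMn lerXn2r ?nnegrE ?addr_ge0 ?mulr_ge0 ?expR_ge0//.
  apply: (@le_trans _ _ (J%:R * (1 + b / J%:R))); last first.
    by rewrite ler_pM2l// expR_ge1Dx.
  by rewrite mulrDr mulr1 mulrC divfK ?gt_eqF// lerD2r ler1n.
rewrite ltnS => Jn; have n0 : (0 < n)%N by exact: leq_trans Jn.
have nR : 0 < n%:R :> R by rewrite ltr0n.
rewrite nbinS.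
have -> : n.+1%:R `^ b = n%:R `^ b * (n.+1%:R / n%:R) `^ b :> R.
  by rewrite -powRM ?divr_ge0 ?ltW// mulrC divfK ?gt_eqF.
rewrite [leRHS]mulrA; apply: ler_pM => //.
- by rewrite nbin_ge0// addr_ge0.
- by rewrite divr_ge0// !addr_ge0.
- exact: IH.
rewrite /powR gt_eqF ?divr_gt0 ?ltr0Sn//.
apply: (@le_trans _ _ (expR (b / n.+1%:R))).
  have -> : (b + 1 + n%:R) / n.+1%:R = 1 + b / n.+1%:R.
    by rewrite -natr1; field; rewrite gt_eqF// ltr_wpDl.
  exact: expR_ge1Dx.
rewrite ler_expR ler_wpM2l//.
have -> : n.+1%:R / n%:R = (1 + - n.+1%:R^-1)^-1 :> R.
  by rewrite -natr1; field; rewrite addrK !gt_eqF// ltr_wpDl.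
have h : 0 < 1 - n.+1%:R^-1 :> R.
  by rewrite subr_gt0 invf_lt1 ?ltr1n.
rewrite lnV// lerNr; apply: le_ln1Dx.
by rewrite ltrNl opprK invf_lt1 ?ltr1n.
Qed.

(** * A discrete Mittag-Leffler function *)

(** The [k]-th term of the expansion in powers of [mu] of the coefficient of
    [z ^+ n] in [(1 - z)^(al - 1) / ((1 - z)^al + mu)]. *)
Definition ml_term (R : realType) (al mu : R) (n k : nat) : R :=
  (- mu) ^+ k * nbin (k%:R * al + 1) n.

Definition ml_approx (R : realType) (al mu : R) (n : nat) : R :=
  limn (series (ml_term al mu n)).

Lemma ml_term_homo (R : realType) (al mu : R) (k : nat) : 0 <= al ->
  {homo (fun n => `|ml_term al mu n k|) : m n / (m <= n)%N >-> m <= n}.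
Proof.
move=> al0 m n mn; have k0 : 0 <= k%:R * al by rewrite mulr_ge0.
rewrite !normrM ler_wpM2l// !ger0_norm ?nbin_ge0 ?addr_ge0//.
exact: nbin_nondecreasing.
Qed.

Lemma cvg_sum_ord (R : realType) n (F : nat -> R^nat) (l : nat -> R) :
  (forall i, F i @ \oo --> l i) ->
  (fun k => \sum_(i < n) F i k) @ \oo --> \sum_(i < n) l i.
Proof.
move=> Fl; elim: n => [|n IH].
  under eq_fun do rewrite big_ord0.
  by rewrite big_ord0; exact: cvg_cst.
under eq_fun do rewrite big_ord_recr.
by rewrite big_ord_recr; apply: cvgD.
Qed.

(** Multiplying the generating function
    [\sum_k (- mu)^k (1 - z)^(- k al - 1)] by [(1 - z)^al] shifts [k] by one: the
    term [k = 0] becomes [nbin (1 - al) n] and the others add up to [- mu] times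
    the original sum. *)
Lemma ml_approx_convolution (R : realType) (al mu C : R) n : 0 <= al ->
  (forall k, `|ml_term al mu n k| <= C / 2 ^+ k) ->
  \sum_(i < n.+1) nbin (- al) i * ml_approx al mu (n - i) =
  nbin (1 - al) n - mu * ml_approx al mu n.
Proof.
move=> al0 HC.
have cb i : series (ml_term al mu (n - i)) @ \oo --> ml_approx al mu (n - i).
  apply: (@cvg_series_dom _ _ C) => k; apply: le_trans (HC k).
  by apply: ml_term_homo => //; exact: leq_subr.
have h1 : (fun K => \sum_(i < n.+1) nbin (- al) i *
    series (ml_term al mu (n - i)) K) @ \oo -->
    \sum_(i < n.+1) nbin (- al) i * ml_approx al mu (n - i).
  apply: (@cvg_sum_ord _ _
    (fun i K => nbin (- al) i * series (ml_term al mu (n - i)) K)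
    (fun i => nbin (- al) i * ml_approx al mu (n - i))) => i.
  by apply: cvgMl_tmp; exact: cb.
have h2 : (fun K => nbin (1 - al) n - mu * series (ml_term al mu n) K) @ \oo -->
    nbin (1 - al) n - mu * ml_approx al mu n.
  apply: cvgB; first exact: cvg_cst.
  by apply: cvgMl_tmp; have := cb 0%N; rewrite subn0.
move: h1; rewrite -cvg_shiftS => h1.
apply: (cvg_unique _ h1); rewrite //=.
apply: cvg_trans h2; apply: near_eq_cvg; apply: nearW => K /=.
apply/esym.
transitivity (\sum_(0 <= k < K.+1) (- mu) ^+ k *
    nbin ((k%:R - 1) * al + 1) n).
  under eq_bigr do rewrite /series/= mulr_sumr.
  rewrite exchange_big/=; apply: eq_bigr => k _.
  have -> : (k%:R - 1) * al + 1 = - al + (k%:R * al + 1) by ring.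
  rewrite -nbin_vandermonde mulr_sumr; apply: eq_bigr => i _.
  by rewrite /ml_term mulrCA.
rewrite big_nat_recl//= expr0 mul1r sub0r mulN1r.
congr (_ + _); first by rewrite addrC.
rewrite /series/= mulr_sumr -sumrN; apply: eq_bigr => k _.
by rewrite /ml_term -natr1 addrK exprS; ring.
Qed.

(** All the coefficients of this recursion are nonnegative when
    [0 <= al <= 1], because [(1 - z)^al] has only one positive coefficient. *)
Lemma ml_approx_rec (R : realType) (al mu C : R) n : 0 <= al ->
  (forall k, `|ml_term al mu n k| <= C / 2 ^+ k) ->
  (1 + mu) * ml_approx al mu n = nbin (1 - al) n +
    \sum_(i < n) (- nbin (- al) i.+1) * ml_approx al mu (n - i.+1).
Proof.
move=> al0 HC; have := ml_approx_convolution al0 HC.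
rewrite big_ord_recl nbin0 subn0 mul1r.
set S := \sum_(_ < _) _ => h; set S' := \sum_(_ < _) _.
have -> : S' = - S by rewrite /S' /S -sumrN; apply: eq_bigr => i _; rewrite mulNr.
by move: h; rewrite mulrDl mul1r; lra.
Qed.

Lemma nbin_opp_ge0 (R : realType) (al : R) i : 0 <= al <= 1 ->
  0 <= - nbin (- al) i.+1.
Proof.
by move=> /andP[? ?]; rewrite oppr_ge0 nbin_le0//; apply/andP; split; lra.
Qed.

Lemma ml_approx_ge0 (R : realType) (al mu C : R) n : 0 <= al <= 1 -> 0 <= mu ->
  (forall k, `|ml_term al mu n k| <= C / 2 ^+ k) -> 0 <= ml_approx al mu n.
Proof.
move=> al01 mu0; have /andP[al0 al1] := al01.
elim/ltn_ind: n => n IH HC.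
have mu1 : 0 < 1 + mu by lra.
rewrite -(pmulr_rge0 _ mu1) (ml_approx_rec al0 HC).
rewrite addr_ge0 ?nbin_ge0 ?subr_ge0//; apply: sumr_ge0 => i _.
rewrite mulr_ge0 ?nbin_opp_ge0//; apply: IH => [|k].
  by rewrite ltn_subrL/= (leq_ltn_trans _ (ltn_ord i)).
by apply: le_trans (HC k); apply: ml_term_homo => //; exact: leq_subr.
Qed.

(** Subtracting the recursions at [mu] and [nu], the differences solve the
    recursion at [mu] with the nonnegative source [(nu - mu) * ml_approx al nu n]. *)
Lemma ml_approx_nonincreasing (R : realType) (al mu nu C D : R) n : 0 <= al <= 1 ->
  0 <= mu <= nu ->
  (forall k, `|ml_term al mu n k| <= C / 2 ^+ k) ->
  (forall k, `|ml_term al nu n k| <= D / 2 ^+ k) ->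
  ml_approx al nu n <= ml_approx al mu n.
Proof.
move=> al01 /andP[mu0 munu]; have /andP[al0 al1] := al01.
elim/ltn_ind: n => n IH HC HD.
have mu1 : 0 < 1 + mu by lra.
rewrite -subr_ge0 -(pmulr_rge0 _ mu1).
have := ml_approx_rec al0 HC; have := ml_approx_rec al0 HD.
set S := \sum_(_ < _) _; set S' := \sum_(_ < _) _ => e1 e2.
have -> : (1 + mu) * (ml_approx al mu n - ml_approx al nu n) =
    (nu - mu) * ml_approx al nu n + (S' - S).
  by move: e1 e2; rewrite mulrBr mulrBl !mulrDl !mul1r; lra.
apply: addr_ge0.
  by rewrite mulr_ge0 ?subr_ge0//; apply: ml_approx_ge0 HD; rewrite // (le_trans mu0).
rewrite -sumrB; apply: sumr_ge0 => i _; rewrite -mulrBr.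
rewrite mulr_ge0 ?nbin_opp_ge0// subr_ge0; apply: IH => [|k|k].
- by rewrite ltn_subrL/= (leq_ltn_trans _ (ltn_ord i)).
- by apply: le_trans (HC k); apply: ml_term_homo => //; exact: leq_subr.
- by apply: le_trans (HD k); apply: ml_term_homo => //; exact: leq_subr.
Qed.

(** The bound is uniform in [n], as Tannery's theorem requires. *)
Lemma ml_term_scaled_le (R : realType) (al x : R) J n k : 0 <= al -> 0 <= x ->
  (0 < J <= n)%N -> x * (expR 1 / J%:R) `^ al <= 2^-1 ->
  `|ml_term al (x / n%:R `^ al) n k| <= J%:R ^+ J / 2 ^+ k.
Proof.
move=> al0 x0 /[dup] Jn /andP[J0 Jn'] hx.
have n0 : 0 < n%:R `^ al :> R by rewrite powR_gt0// ltr0n (leq_trans J0).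
have kal : 0 <= k%:R * al by rewrite mulr_ge0.
have xn0 : 0 <= x / n%:R `^ al by rewrite divr_ge0// ltW.
have b0 : 0 <= nbin (k%:R * al + 1) n by rewrite nbin_ge0// addr_ge0.
rewrite /ml_term normrM normrX normrN (ger0_norm xn0) (ger0_norm b0).
apply: le_trans (ler_wpM2l _ (nbin_le_powR kal Jn)) _.
  by rewrite exprn_ge0// divr_ge0// ltW.
rewrite mulrC (mulrC k%:R) !powRrM !powR_mulrn ?powR_ge0//.
rewrite -!mulrA ler_wpM2l ?exprn_ge0// -!exprMn -exprVn.
rewrite lerXn2r ?nnegrE//.
- by rewrite mulr_ge0 ?powR_ge0// mulr_ge0 ?powR_ge0 ?divr_ge0// ltW.
- rewrite [leLHS](_ : _ = x * (expR 1 / J%:R) `^ al)//.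
  by field; rewrite gt_eqF.
Qed.

Lemma ml_term_ratio_le_half (R : realType) (al x : R) : 0 < al -> 0 <= x ->
  exists2 J, (0 < J)%N & x * (expR 1 / J%:R) `^ al <= 2^-1.
Proof.
move=> al0 x0; pose r := (2 * (x + 1))^-1 `^ al^-1.
have x1 : 0 < x + 1 by lra.
have r0 : 0 < r by rewrite powR_gt0// invr_gt0 mulr_gt0.
have [J hJ] : exists J : nat, expR 1 / r < J%:R.
  by exists (Num.bound (expR 1 / r)); rewrite archi_boundP// divr_ge0 ?expR_ge0// ltW.
have J0 : 0 < J%:R :> R by apply: le_lt_trans hJ; rewrite divr_ge0 ?expR_ge0// ltW.
exists J; first by rewrite -(ltr0n R).
have h : (expR 1 / J%:R) `^ al <= (2 * (x + 1))^-1.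
  have -> : (2 * (x + 1))^-1 = r `^ al.
    by rewrite /r -powRrM mulVf ?gt_eqF// powRr1// invr_ge0 mulr_ge0// ltW.
  apply: ge0_ler_powR; rewrite ?nnegrE ?divr_ge0 ?expR_ge0// ?ltW//.
  by rewrite ltr_pdivrMr// mulrC -ltr_pdivrMr.
apply: le_trans (ler_wpM2l x0 h) _.
by rewrite invfM mulrCA ler_piMr ?invr_ge0// ler_pdivrMr// mul1r lerDl.
Qed.

(** * Gauss's limit for the Gamma function *)

Lemma Rintegral_dominated_cvg d (T : measurableType d) (R : realType)
    (mu : {measure set T -> \bar R}) (D : set T) (f_ : (T -> R)^nat)
    (f g : T -> R) : measurable D ->
  (forall n, measurable_fun D (f_ n)) ->
  (forall x, D x -> (fun n => f_ n x) @ \oo --> f x) ->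
  mu.-integrable D (EFin \o g) ->
  (forall n x, D x -> `|f_ n x| <= g x) ->
  mu.-integrable D (EFin \o f) /\
  (fun n => \int[mu]_(x in D) f_ n x) @ \oo --> \int[mu]_(x in D) f x.
Proof.
move=> mD mf_ f_f ig f_g.
have ff x : D x -> (fun n => (f_ n x)%:E) @ \oo --> (f x)%:E.
  by move=> Dx; apply/cvg_EFin; [exact: nearW|exact: f_f].
have mf : measurable_fun D (EFin \o f).
  by apply: (emeasurable_fun_cvg (fun n => EFin \o f_ n)) ff => n; exact/measurable_EFinP.
have [|||intf _ cf] := dominated_convergence mD
    (f_ := fun n => EFin \o f_ n) _ mf _ ig.
- by move=> n; exact/measurable_EFinP.
- by apply: aeW => x Dx; exact: ff.
- by apply: aeW => x n Dx; rewrite /= lee_fin f_g.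
split=> //; apply: fine_cvg; rewrite fineK//.
exact: integrable_fin_num.
Qed.

Lemma powR_within_continuous (R : realType) (b N : R) : 0 <= b -> 0 < N ->
  {within `[0, N], continuous (fun x : R => x `^ b)}.
Proof.
move=> b0 N0; have [->|bn0] := eqVneq b 0.
  by apply: continuous_subspaceT => x; under eq_fun do rewrite powRr0; exact: cvg_cst.
have b1 : 0 < b by rewrite lt_neqAle eq_sym bn0.
have cb (x : R) : 0 < x -> {for x, continuous (fun x : R => x `^ b)}.
  move=> x0; apply: differentiable_continuous; apply/derivable1_diffP.
  by apply: derivable_powR; rewrite in_itv/= andbT.
apply/continuous_within_itvP => //; split.
- by move=> x; rewrite in_itv/= => /andP[x0 _]; exact: cb.
- by rewrite powR0//; exact: powR_cvg0.
- by apply: cvg_at_left_filter; exact: cb.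
Qed.

Lemma Rintegral_powR (R : realType) (b N : R) : 0 <= b -> 0 < N ->
  \int[lebesgue_measure]_(x in `[0, N]) (x `^ b) = N `^ (b + 1) / (b + 1).
Proof.
move=> b0 N0; have b1 : 0 < b + 1 by rewrite ltr_wpDl.
have /continuous_within_itvP -/(_ N0)[cF Fl Fr] :=
  @powR_within_continuous _ (b + 1) N (ltW b1) N0.
have dF (x : R) : 0 < x ->
    is_derive x 1 (fun x : R => (b + 1)^-1 * x `^ (b + 1)) (x `^ b).
  move=> x0; have -> : x `^ b = (b + 1)^-1 *: ((b + 1) * x `^ (b + 1 - 1)) :> R^o.
    by rewrite addrK /GRing.scale/= mulKf ?gt_eqF.
  exact: is_deriveZ (is_derive1_powR (b + 1) x0).
rewrite /Rintegral (@continuous_FTC2 _ _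
  (fun x => (b + 1)^-1 * x `^ (b + 1)))//=.
- by rewrite powR0 ?gt_eqF// mulr0 subr0 mulrC.
- exact: powR_within_continuous.
- split.
  + by move=> x; rewrite in_itv/= => /andP[x0 _]; have [] := dF _ x0.
  + by apply: cvgMl_tmp.
  + by apply: cvgMl_tmp.
- move=> x; rewrite in_itv/= => /andP[x0 _].
  by rewrite derive1E; have [] := dF _ x0.
Qed.

Lemma beta_integrand_continuous (R : realType) (m : nat) (b N : R) :
  0 <= b -> 0 < N ->
  {within `[0, N], continuous (fun x : R => (1 - x / N) ^+ m * x `^ b)}.
Proof.
move=> b0 N0 x; apply: cvgM; last exact: (powR_within_continuous b0 N0).
have c : continuous (fun x : R => (1 - x / N) ^+ m).
  move=> y; apply: (@continuous_comp _ _ _ (fun x : R => 1 - x / N)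
    (fun x => x ^+ m)); last exact: exprn_continuous.
  by apply: cvgB; [exact: cvg_cst|apply: cvgMr_tmp; exact: cvg_id].
exact: (continuous_subspaceT c).
Qed.

Lemma beta_integrand_integrable (R : realType) (m : nat) (b N : R) :
  0 <= b -> 0 < N ->
  lebesgue_measure.-integrable `[0, N]
    (EFin \o (fun x : R => (1 - x / N) ^+ m * x `^ b)).
Proof.
move=> b0 N0; apply: continuous_compact_integrable.
  exact: segment_compact.
exact: beta_integrand_continuous.
Qed.

(** Expanding one factor [1 - x / N] gives a recursion in [m] that shifts [b],
    which avoids integrating by parts. *)
Lemma Rintegral_beta (R : realType) (m : nat) (b N : R) : 0 <= b -> 0 < N ->
  \int[lebesgue_measure]_(x in `[0, N]) ((1 - x / N) ^+ m * x `^ b) =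
  m`!%:R * N `^ (b + 1) / \prod_(j < m.+1) (b + 1 + j%:R).
Proof.
move=> + N0; elim: m b => [|m IH] b b0.
  rewrite big_ord1 addr0 fact0 mul1r -Rintegral_powR//.
  by apply: eq_Rintegral => x _; rewrite expr0 mul1r.
have b1 : 0 <= b + 1 by rewrite addr_ge0.
transitivity (\int[lebesgue_measure]_(x in `[0, N])
   ((1 - x / N) ^+ m * x `^ b - N^-1 * ((1 - x / N) ^+ m * x `^ (b + 1)))).
  apply: eq_Rintegral => x; rewrite inE/= in_itv/= => /andP[x0 _].
  rewrite -(@mulr_powRB1 _ x (b + 1)) ?ltr_wpDl// addrK exprS.
  by field; rewrite gt_eqF.
have ib := beta_integrand_integrable m b0 N0.
have ib1 := beta_integrand_integrable m b1 N0.
rewrite RintegralB//; last first.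
  exact: (integrableZl _ _ ib1).
rewrite RintegralZl// !IH//.
rewrite (big_ord_recl m.+1) (big_ord_recl m) addr0.
have e : \prod_(i < m) (b + 1 + (lift ord0 i)%:R) =
    \prod_(i < m) (b + 1 + 1 + i%:R) :> R.
  by apply: eq_bigr => i _; rewrite /= /bump/= add1n -nat1r addrA.
have e' : \prod_(i < m.+1) (b + 1 + (lift ord0 i)%:R) =
    \prod_(i < m.+1) (b + 1 + 1 + i%:R) :> R.
  by apply: eq_bigr => i _; rewrite /= /bump/= add1n -nat1r addrA.
rewrite e e' big_ord_recr/=; set Q := \prod_(_ < _) _.
have Q0 : 0 < Q.
  by apply: prodr_gt0 => i _; rewrite ltr_wpDr// ltr_wpDl.
have -> : N `^ (b + 1 + 1) = N * N `^ (b + 1).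
  have p2 : 0 < b + 1 + 1 by lra.
  by rewrite -(mulr_powRB1 (ltW N0) p2) addrK.
rewrite factS natrM -natr1; field.
have m0 : 0 <= m%:R :> R by [].
by rewrite !gt_eqF//=; lra.
Qed.

Lemma onem_div_expn_le (R : realType) (x : R) (n : nat) :
  x <= n.+1%:R -> (1 - x / n.+1%:R) ^+ n.+1 <= expR (- x).
Proof.
move=> xn.
have -> : expR (- x) = expR (- (x / n.+1%:R)) ^+ n.+1.
  by rewrite -expRM_natr mulNr divfK.
have h : 0 <= 1 - x / n.+1%:R by rewrite subr_ge0 ler_pdivrMr ?ltr0Sn// mul1r.
by rewrite lerXn2r ?nnegrE ?expR_ge0// -[1 - _]addrC addrC expR_ge1Dx.
Qed.

Lemma onem_div_expn_ge (R : realType) (x : R) (n : nat) : 0 <= x ->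
  x < n.+1%:R -> expR (- x / (1 - x / n.+1%:R)) <= (1 - x / n.+1%:R) ^+ n.+1.
Proof.
move=> x0 xn; set y := x / n.+1%:R.
have y1 : 0 < 1 - y by rewrite subr_gt0 ltr_pdivrMr ?ltr0Sn// mul1r.
have -> : expR (- x / (1 - y)) = expR (- (y / (1 - y))) ^+ n.+1.
  have xE : x = y * n.+1%:R by rewrite /y divfK.
  by rewrite -expRM_natr; congr expR; rewrite [in LHS]xE -!mulNr mulrAC.
rewrite lerXn2r ?nnegrE ?expR_ge0 ?(ltW y1)// expRN.
rewrite -[leRHS]invrK lef_pV2 ?posrE ?expR_gt0 ?invr_gt0//.
apply: le_trans (expR_ge1Dx _).
by rewrite le_eqVlt; apply/orP; left; apply/eqP; field; rewrite gt_eqF.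
Qed.

Lemma cvg_onem_div_expn (R : realType) (x : R) : 0 <= x ->
  (fun n => (1 - x / n.+1%:R) ^+ n.+1) @ \oo --> expR (- x).
Proof.
move=> x0.
have xn0 : (fun n : nat => x / n.+1%:R) @ \oo --> (0 : R).
  by rewrite -(mulr0 x); apply: cvgMl_tmp; exact: cvg_harmonic.
have lo : (fun n : nat => expR (- x / (1 - x / n.+1%:R))) @ \oo --> expR (- x).
  apply: continuous_cvg; first exact: continuous_expR.
  rewrite -[X in _ --> X]mulr1; apply: cvgMl_tmp.
  rewrite -[X in _ --> X]invr1; apply: cvgV; first exact: oner_neq0.
  rewrite -[X in _ --> X]subr0; apply: cvgB => //; exact: cvg_cst.
apply: (squeeze_cvgr _ lo); last exact: cvg_cst.
have [n0 hn0] : exists n : nat, x < n%:R.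
  by exists (Num.bound x); rewrite archi_boundP.
exists n0 => // n /= nn0; have xn : x < n.+1%:R.
  by apply: lt_le_trans hn0 _; rewrite ler_nat leqW.
by rewrite onem_div_expn_ge// onem_div_expn_le// ltW.
Qed.

Lemma powR_le_expR_half (R : realType) (b x : R) : 0 <= b -> 0 < x ->
  x `^ b <= (2 * (b + 1)) `^ b * expR (x / 2).
Proof.
move=> b0 x0; set c := 2 * (b + 1).
have c0 : 0 < c by rewrite /c; lra.
have xE : x = c * (x / c) by rewrite mulrC divfK ?gt_eqF.
have xc0 : 0 <= x / c by rewrite divr_ge0 ?ltW.
rewrite {1}xE powRM ?(ltW c0)// ler_wpM2l ?powR_ge0//.
apply: (@le_trans _ _ (expR (x / c) `^ b)).
  apply: ge0_ler_powR; rewrite ?nnegrE ?expR_ge0//.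
  by apply: le_trans (expR_ge1Dx _); rewrite lerDr.
rewrite -expRM ler_expR -mulrA ler_wpM2l ?(ltW x0)//.
rewrite /c invfM -mulrA ler_piMr ?invr_ge0// mulrC ler_pdivrMr ?mul1r; lra.
Qed.

Lemma measurable_Gamma_integrand (R : realType) (b : R) (D : set R) :
  measurable_fun D (fun x : R => x `^ b * expR (- x)).
Proof.
apply: measurable_funTS; apply: measurable_funM; first exact: measurable_powR.
by apply: measurableT_comp => //; exact: measurable_oppr.
Qed.

Lemma Gamma_integrable (R : realType) (b : R) : 0 <= b ->
  lebesgue_measure.-integrable `]0, +oo[
    (EFin \o (fun x : R => x `^ b * expR (- x))).
Proof.
move=> b0; pose C := (2 * (b + 1)) `^ b.
have C0 : 0 <= C by exact: powR_ge0.
have half0 : 0 < 2^-1 :> R by rewrite invr_gt0.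
have ip : lebesgue_measure.-integrable `]0, +oo[
    (EFin \o (fun x : R => 2 * C * exponential_pdf 2^-1 x)).
  apply: (@integrableS _ _ _ _ setT) => //.
  exact: (integrableZl _ _ (integrable_exponential_pdf half0)).
apply: (le_integrable _ _ _ ip) => //.
  by apply/measurable_EFinP; exact: measurable_Gamma_integrand.
move=> x; rewrite /= in_itv/= andbT => x0; rewrite lee_fin.
rewrite exponential_pdfE ?(ltW x0)//.
rewrite !ger0_norm ?mulr_ge0 ?expR_ge0 ?powR_ge0//.
apply: le_trans (ler_wpM2r (expR_ge0 _) (powR_le_expR_half b0 x0)) _.
rewrite -[leLHS]mulrA -expRD.
have -> : x / 2 + - x = - 2^-1 * x by field.
by rewrite le_eqVlt -/C; apply/orP; left; apply/eqP; field.
Qed.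

(** Dominated convergence applies since [(1 - x / n)^n] tends to [expR (- x)]
    from below; positivity of the limit is that of the first integral. *)
Lemma cvg_beta_Gamma (R : realType) (b : R) : 0 <= b ->
  0 < Gamma (b + 1) /\
  (fun n => \int[lebesgue_measure]_(x in `[0, n.+1%:R])
    ((1 - x / n.+1%:R) ^+ n.+1 * x `^ b)) @ \oo --> Gamma (b + 1).
Proof.
move=> b0; pose D : set R := `]0, +oo[%classic.
have mD : measurable D by exact: measurable_itv.
pose h (n : nat) (x : R) := (1 - x / n.+1%:R) ^+ n.+1 * x `^ b.
pose F (n : nat) := h n \_ `[0, n.+1%:R].
have GE : Gamma (b + 1) =
    \int[lebesgue_measure]_(x in D) (x `^ b * expR (- x)).
  by apply: eq_Rintegral => x _; rewrite addrK.
have FE n : \int[lebesgue_measure]_(x in D) F n x =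
    \int[lebesgue_measure]_(x in `[0, n.+1%:R]) h n x.
  rewrite -Rintegral_mkcondr.
  have -> : D `&` `[0, n.+1%:R] = `]0, n.+1%:R]%classic.
    rewrite /D; apply/seteqP; split=> x /=; rewrite !in_itv/= ?andbT.
      by move=> [-> /andP[_ ->]].
    by move=> /andP[x0 ->]; rewrite x0 ltW.
  rewrite Rintegral_itv_obnd_cbnd//.
  apply: (integrableS _ _ _ (beta_integrand_integrable n.+1 b0 _)) => //.
  exact: subset_itv_oc_cc.
have mF n : measurable_fun D (F n).
  apply/(measurable_restrict _ (measurable_itv _) mD); apply: measurable_funTS.
  apply: measurable_funM; last exact: measurable_powR.
  apply: measurable_funX; apply: measurable_funB => //.
  exact: measurable_funM.
have hle n x : D x -> 0 <= F n x <= x `^ b * expR (- x).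
  rewrite /D /= in_itv/= andbT => x0; rewrite /F patchE.
  case: ifPn => [|_]; last by rewrite lexx mulr_ge0 ?powR_ge0 ?expR_ge0.
  rewrite inE/= in_itv/= => /andP[_ xn].
  rewrite /h mulrC ler_wpM2l ?powR_ge0 ?onem_div_expn_le// andbT.
  by rewrite mulr_ge0 ?powR_ge0// exprn_ge0// subr_ge0 ler_pdivrMr// mul1r.
have [|||intg cg] := @Rintegral_dominated_cvg _ _ _ lebesgue_measure D F
    (fun x => x `^ b * expR (- x)) (fun x => x `^ b * expR (- x)) _ mF _
    (Gamma_integrable b0).
- by [].
- move=> x; rewrite /D /= in_itv/= andbT => x0.
  have c : (fun n => h n x) @ \oo --> x `^ b * expR (- x).
    by rewrite mulrC; apply: cvgMr_tmp; exact: cvg_onem_div_expn (ltW x0).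
  apply: cvg_trans c; apply: near_eq_cvg.
  exists (Num.bound x) => // n /= nn0.
  rewrite /F patchE mem_set//= in_itv/= (ltW x0)/=.
  apply: le_trans (ltW (archi_boundP (ltW x0))) _.
  by rewrite ler_nat leqW.
- by move=> n x Dx; have /andP[F0 F1] := hle n x Dx; rewrite ger0_norm.
split; last first.
  by rewrite GE; apply: cvg_trans cg; apply: near_eq_cvg; apply: nearW => n.
rewrite GE; apply: (@lt_le_trans _ _ (\int[lebesgue_measure]_(x in D) F 0%N x)).
  rewrite FE /h Rintegral_beta// powR1 mulr1 divr_gt0//.
    by apply: prodr_gt0 => i _; rewrite ltr_wpDr// ltr_wpDl.
apply: le_Rintegral => //.
- apply: (le_integrable _ _ _ (Gamma_integrable b0)) => //.
    by apply/measurable_EFinP; exact: mF.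
  move=> x Dx; have /andP[F0 F1] := hle 0%N x Dx.
  rewrite /= lee_fin ger0_norm// ger0_norm//; exact: le_trans F1.
- by move=> x Dx; have /andP[] := hle 0%N x Dx.
Qed.

Lemma nbinE (R : realType) (b : R) n :
  \prod_(j < n) (b + j%:R) = n`!%:R * nbin b n.
Proof.
elim: n => [|n IH]; first by rewrite big_ord0 nbin0 mulr1.
rewrite big_ord_recr/= IH nbinS factS natrM; field.
by rewrite addrC natr1 pnatr_eq0.
Qed.

(** The integral in [cvg_beta_Gamma] at [n] equals [n `^ b / nbin (b + 1) n] up to
    the factor [n / (b + 1 + n)], which tends to [1]. *)
Lemma gauss_Gamma (R : realType) (b : R) : 0 <= b ->
  (fun n => nbin (b + 1) n / n%:R `^ b) @ \oo --> (Gamma (b + 1))^-1.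
Proof.
move=> b0; have [G0 cG] := cvg_beta_Gamma b0.
rewrite -cvg_shiftS.
have c1 : (fun n : nat => 1 - (b + 1) * ((b + 1) + n.+1%:R)^-1) @ \oo --> (1 : R).
  rewrite -[X in _ --> X]subr0; apply: cvgB; first exact: cvg_cst.
  rewrite -(mulr0 (b + 1)); apply: cvgMl_tmp.
  apply: (squeeze_cvgr _ (cvg_cst 0) cvg_harmonic).
  apply: nearW => n /=; rewrite invr_ge0 addr_ge0 ?addr_ge0//=.
  by rewrite lef_pV2 ?posrE// ?ltr_wpDl ?addr_ge0// lerDr addr_ge0.
have c2 : (fun n : nat => (1 - (b + 1) * ((b + 1) + n.+1%:R)^-1) *
    (\int[lebesgue_measure]_(x in `[0, n.+1%:R])
    ((1 - x / n.+1%:R) ^+ n.+1 * x `^ b))^-1) @ \oo --> 1 * (Gamma (b + 1))^-1.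
  by apply: cvgM => //; apply: cvgV => //; exact: lt0r_neq0.
rewrite mul1r in c2; move: c2; apply: cvg_trans; apply: near_eq_cvg.
apply: nearW => n /=.
have n0 : 0 < n.+1%:R :> R by [].
rewrite Rintegral_beta// big_ord_recr/= nbinE.
have nb0 : nbin (b + 1) n.+1 != 0.
  by apply/prodf_neq0 => j _; rewrite mulf_neq0 ?invr_eq0 ?gt_eqF// ltr_wpDr// ltr_wpDl.
have -> : n.+1%:R `^ (b + 1) = n.+1%:R * n.+1%:R `^ b :> R.
  by rewrite -(@mulr_powRB1 _ _ (b + 1)) ?addrK// ltr_wpDl.
have p0 : n.+1%:R `^ b != 0 :> R by rewrite gt_eqF// powR_gt0.
have q0 : b + 1 + n.+1%:R != 0 by rewrite gt_eqF// ltr_wpDl// addr_ge0.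
have f0 : n.+1`!%:R != 0 :> R by rewrite pnatr_eq0 -lt0n fact_gt0.
by field; rewrite nat1r p0 q0 f0 nb0 gt_eqF.
Qed.

(** * The Mittag-Leffler function on the negative half-line *)

Lemma cvg_ml_term (R : realType) (al x : R) k : 0 <= al ->
  (fun n => ml_term al (x / n%:R `^ al) n k) @ \oo -->
  (- x) ^+ k / Gamma (k%:R * al + 1).
Proof.
move=> al0; have kal : 0 <= k%:R * al by rewrite mulr_ge0.
have c : (fun n => (- x) ^+ k * (nbin (k%:R * al + 1) n / n%:R `^ (k%:R * al)))
    @ \oo --> (- x) ^+ k / Gamma (k%:R * al + 1).
  by apply: cvgMl_tmp; exact: gauss_Gamma.
apply: cvg_trans c; apply: near_eq_cvg; exists 1%N => // n /= n0.
rewrite /ml_term -mulNr exprMn exprVn (mulrC k%:R) powRrM powR_mulrn ?powR_ge0//.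
by rewrite -[RHS]mulrA [in RHS](mulrC _^-1).
Qed.

Lemma cvg_ml_approx (R : realType) (al x : R) : 0 < al -> 0 <= x ->
  (fun n => ml_approx al (x / n%:R `^ al) n) @ \oo --> mittag_leffler al (- x).
Proof.
move=> al0 x0; have [J J0 HJ] := ml_term_ratio_le_half al0 x0.
apply: (@cvg_series_tannery _ (fun n => ml_term al (x / n%:R `^ al) n) _ (J%:R ^+ J)).
  by move=> k; exact: cvg_ml_term (ltW al0).
exists J => // n /= Jn k; apply: ml_term_scaled_le => //; first exact: ltW.
by rewrite J0.
Qed.

Lemma mittag_leffler_nonincreasing (R : realType) (al x y : R) : 0 < al <= 1 ->
  0 <= x <= y -> mittag_leffler al (- y) <= mittag_leffler al (- x).
Proof.
move=> /andP[al0 al1] /andP[x0 xy]; have y0 := le_trans x0 xy.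
have [J J0 HJ] := ml_term_ratio_le_half al0 x0.
have [K K0 HK] := ml_term_ratio_le_half al0 y0.
apply: ler_cvg_to (cvg_ml_approx al0 y0)
  (cvg_ml_approx al0 x0) _.
exists (maxn J K) => // n /=; rewrite geq_max => /andP[Jn Kn].
apply: (@ml_approx_nonincreasing _ _ _ _ (J%:R ^+ J) (K%:R ^+ K)).
- by rewrite al1 ltW.
- by rewrite divr_ge0 ?powR_ge0//= ler_wpM2r// invr_ge0 powR_ge0.
- by move=> k; apply: ml_term_scaled_le => //; [exact: ltW|rewrite J0].
- by move=> k; apply: ml_term_scaled_le => //; [exact: ltW|rewrite K0].
Qed.

Lemma mittag_leffler_ge0 (R : realType) (al x : R) : 0 < al <= 1 -> 0 <= x ->
  0 <= mittag_leffler al (- x).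
Proof.
move=> /andP[al0 al1] x0; have [J J0 HJ] := ml_term_ratio_le_half al0 x0.
apply: cvgr_to_ge (cvg_ml_approx al0 x0) _.
exists J => // n /= Jn; apply: (@ml_approx_ge0 _ _ _ (J%:R ^+ J)).
- by rewrite al1 ltW.
- by rewrite divr_ge0 ?powR_ge0.
- by move=> k; apply: ml_term_scaled_le => //; [exact: ltW|rewrite J0].
Qed.

Lemma Gamma1 (R : realType) : Gamma (1 : R) = 1.
Proof.
have := @gauss_Gamma R 0 (lexx 0); rewrite add0r => h.
apply: invr_inj; rewrite invr1; apply: (cvg_unique _ h) => //.
suff -> : (fun n => nbin 1 n / n%:R `^ 0) = (fun=> 1 : R) by exact: cvg_cst.
apply/funext => n; rewrite powRr0 divr1 /nbin big1// => j _.
by rewrite nat1r divff// pnatr_eq0.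
Qed.

Lemma mittag_leffler0 (R : realType) (al : R) : mittag_leffler al 0 = 1.
Proof.
apply: cvg_lim => //; rewrite -cvg_shiftS.
have c : (fun=> 1 : R) @ \oo --> (1 : R) by exact: cvg_cst.
apply: cvg_trans c; apply: near_eq_cvg; apply: nearW => n /=.
rewrite /series/= big_nat_recl//= expr0 mul0r add0r Gamma1 divr1.
by rewrite big1 ?addr0// => i _; rewrite expr0n mul0r.
Qed.

(** Tannery's theorem along [x = 1 / (n + 1)] gives the limit [1] at [0], and
    monotonicity transfers the bound to all smaller [x]. *)
Lemma mittag_leffler_near0 (R : realType) (al c : R) : 0 < al <= 1 -> c < 1 ->
  exists2 d, 0 < d &
    forall x, 0 <= x <= d -> c < mittag_leffler al (- x).
Proof.
move=> /[dup] al01 /andP[al0 al1] c1.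
have [J J0 HJ] := ml_term_ratio_le_half al0 (@ler01 R).
have HG k : `|(Gamma (k%:R * al + 1))^-1| <= J%:R ^+ J / 2 ^+ k.
  have := @cvg_ml_term _ _ 1 k (ltW al0) => /cvg_norm.
  rewrite normrM normrX normrN normr1 expr1n mul1r => h.
  apply: (cvgr_to_le h); exists J => // n /= Jn.
  by apply: ml_term_scaled_le => //; [exact: ltW|rewrite J0].
have : (fun n => mittag_leffler al (- n.+1%:R^-1)) @ \oo --> (1 : R).
  rewrite -[X in _ --> X](mittag_leffler0 al).
  apply: (@cvg_series_tannery _ (fun n k => (- n.+1%:R^-1) ^+ k / Gamma (k%:R * al + 1))
    _ (J%:R ^+ J)) => [k|].
    apply: cvgMr_tmp; apply: (@continuous_cvg _ _ _ _ _ _ (fun x : R => x ^+ k)).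
      exact: exprn_continuous.
    by rewrite -oppr0; apply: cvgN; exact: cvg_harmonic.
  apply: nearW => n k; rewrite normrM; apply: le_trans (HG k).
  rewrite ler_piMl// normrX normrN exprn_ile1// ger0_norm//.
  by rewrite invf_le1// ler1n.
move=> /cvgrPdist_lt /(_ (1 - c)); rewrite subr_gt0 => /(_ c1) [n _ /(_ n (leqnn n))].
rewrite /= ltr_norml => /andP[_ h].
exists n.+1%:R^-1 => // x /andP[x0 xn].
have : mittag_leffler al (- n.+1%:R^-1) <= mittag_leffler al (- x).
  by apply: mittag_leffler_nonincreasing => //; rewrite x0.
by apply: lt_le_trans; move: h; lra.
Qed.

(** * Monotone weights against functions with nonnegative tail integrals *)

(** An upper level set of a nondecreasing function is an interval ending at [b],
    up to its left endpoint, which has measure zero. *)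
Lemma Rintegral_upper_ge (R : realType) (K p : R -> R) (b u y C : R) :
  {homo K : s t / s <= t} ->
  lebesgue_measure.-integrable `[0, b] (EFin \o p) ->
  0 <= u <= b -> y <= K u ->
  (forall s, 0 <= s <= u -> C <= \int[lebesgue_measure]_(x in `[s, b]) p x) ->
  C <= \int[lebesgue_measure]_(x in `[0, b] `&` [set x | y <= K x]) p x.
Proof.
move=> homoK ip ub yKu HC; have /andP[u0 u1] := ub.
set U := _ `&` _.
have Uu : U u by split; rewrite //= in_itv/= u0 u1.
have U0 : has_inf U.
  split; first by exists u.
  by exists 0 => x [+ _]; rewrite /= in_itv/= => /andP[].
set s := inf U.
have su : s <= u by apply: ge_inf => //; exact: U0.2.
have s0 : 0 <= s.
  apply: lb_le_inf; first exact: U0.1.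
  by move=> x [+ _]; rewrite /= in_itv/= => /andP[].
have gtU x : s < x -> x <= b -> U x.
  move=> sx xb; split.
    by rewrite /= in_itv/= xb andbT (le_trans s0)// ltW.
  have e0 : 0 < x - s by rewrite subr_gt0.
  have [v [_ /= yv] vx] := inf_adherent e0 U0.
  apply: le_trans yv _; apply: homoK; apply: ltW.
  by move: vx; rewrite -/s subrKC.
have geU x : U x -> s <= x by move=> Ux; apply: ge_inf => //; exact: U0.2.
have leb x : U x -> x <= b by move=> [/=]; rewrite in_itv/= => /andP[].
have isub : lebesgue_measure.-integrable `]s, b] (EFin \o p).
  apply: integrableS ip => // x /=; rewrite !in_itv/= => /andP[sx ->].
  by rewrite andbT (le_trans s0)// ltW.
have := HC s; rewrite s0 su => /(_ isT).
have [Us|nUs] := pselect (U s).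
  suff -> : U = `[s, b]%classic by [].
  apply/seteqP; split=> x /=; rewrite in_itv/=.
    by move=> Ux; rewrite geU// leb.
  by move=> /andP[]; rewrite le_eqVlt => /predU1P[<-//|]; exact: gtU.
suff -> : U = `]s, b]%classic by rewrite Rintegral_itv_obnd_cbnd.
apply/seteqP; split=> x /=; rewrite in_itv/=.
  move=> Ux; rewrite leb// andbT lt_neqAle geU// andbT.
  by apply/eqP => sx; apply: nUs; rewrite sx.
by move=> /andP[]; exact: gtU.
Qed.

(** The sum is the integer part of [x], as long as [x < n + 1]. *)
Lemma count_steps (R : realType) (x : R) n : 0 <= x ->
  (\sum_(j < n) (j.+1%:R <= x)%R%:R : R) <= x /\
  (x < n.+1%:R -> x <= \sum_(j < n) (j.+1%:R <= x)%R%:R + 1).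
Proof.
move=> x0; suff [H1 [H2 H3]] :
    (\sum_(j < n) (j.+1%:R <= x)%R%:R <= x) /\
    (n%:R <= x -> \sum_(j < n) (j.+1%:R <= x)%R%:R = n%:R :> R) /\
    (x < n%:R -> x <= \sum_(j < n) (j.+1%:R <= x)%R%:R + 1).
  split=> // xn; have [nx|/H3//] := leP n%:R x.
  by rewrite H2// natr1 ltW.
elim: n => [|n [H1 [H2 H3]]].
  rewrite big_ord0; split => //; split => // x1.
  by move: (lt_le_trans x1 x0); rewrite ltxx.
have nn : n%:R <= n.+1%:R :> R by rewrite ler_nat.
have [nx|xn] := leP n.+1%:R x; last (have nxF := lt_geF xn); split.
- by rewrite big_ord_recr/= nx/= H2 ?natr1// (le_trans nn).
- split=> // _; rewrite big_ord_recr/= nx H2 ?natr1// (le_trans nn)//.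
- by rewrite big_ord_recr/= nxF addr0.
split; first by [].
move=> _; rewrite big_ord_recr/= nxF addr0.
have [nx|/H3//] := leP n%:R x.
by rewrite H2// natr1 ltW.
Qed.

Lemma integrable_sum_ord (R : realType) (D : set R) n (f : nat -> R -> R) :
  measurable D ->
  (forall i, lebesgue_measure.-integrable D (EFin \o f i)) ->
  lebesgue_measure.-integrable D (EFin \o (fun x => \sum_(i < n) f i x)).
Proof.
move=> mD fi; have -> : (EFin \o (fun x => \sum_(i < n) f i x)) =
    (fun x => (\sum_(i < n) (EFin \o f i) x)%E).
  by apply/funext => x /=; rewrite sumEFin.
by apply: integrable_sum.
Qed.

Lemma Rintegral_sum_ord (R : realType) (D : set R) n (f : nat -> R -> R) :
  measurable D ->
  (forall i, lebesgue_measure.-integrable D (EFin \o f i)) ->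
  \int[lebesgue_measure]_(x in D) (\sum_(i < n) f i x) =
  \sum_(i < n) \int[lebesgue_measure]_(x in D) f i x.
Proof.
move=> mD fi; elim: n => [|n IH].
  rewrite big_ord0; under eq_Rintegral do rewrite big_ord0.
  by rewrite Rintegral_cst// mul0r.
rewrite big_ord_recr/= -IH -RintegralD//; last exact: integrable_sum_ord.
by apply: eq_Rintegral => x _; rewrite big_ord_recr.
Qed.

(** A discrete layer-cake argument: up to an error [1 / n], [K] is the average of
    the indicators of the level sets [j / n <= K] for [0 < j <= n].  Each level
    set contributes a nonnegative amount, and those with [j / n <= K a] contain
    [a] and contribute at least [M]. *)
Lemma Rintegral_nondecreasing_ge (R : realType) (K p : R -> R) (a b M : R) :
  {homo K : s t / s <= t} -> (forall s, 0 <= K s <= 1) ->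
  0 <= a <= b -> 0 <= M ->
  lebesgue_measure.-integrable `[0, b] (EFin \o p) ->
  (forall s, 0 <= s <= b -> 0 <= \int[lebesgue_measure]_(x in `[s, b]) p x) ->
  (forall s, 0 <= s <= a -> M <= \int[lebesgue_measure]_(x in `[s, b]) p x) ->
  K a * M <= \int[lebesgue_measure]_(x in `[0, b]) (K x * p x).
Proof.
move=> homoK K01 ab M0 ip H0 HM.
have K0 s : 0 <= K s by case/andP: (K01 s).
have K1 s : K s <= 1 by case/andP: (K01 s).
pose D : set R := `[0, b]%classic.
have mD : measurable D by exact: measurable_itv.
have mK : measurable_fun D K by exact: nondecreasing_measurable.
have mp : measurable_fun D p.
  by apply/measurable_EFinP; exact: (measurable_int _ ip).
have ibd (h : R -> R) : measurable_fun D h -> (forall x, `|h x| <= 1) ->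
    lebesgue_measure.-integrable D (EFin \o (fun x => h x * p x)).
  move=> mh h1; apply: le_integrable ip => //.
    by apply/measurable_EFinP; apply: measurable_funM.
  by move=> x _ /=; rewrite lee_fin normrM ler_piMl.
have iKp : lebesgue_measure.-integrable D (EFin \o (fun x => K x * p x)).
  by apply: ibd => // x; rewrite ger0_norm.
have ipn : lebesgue_measure.-integrable D (EFin \o (fun x => `|p x|)).
  exact: (integrable_abse ip).
set I := \int[lebesgue_measure]_(x in D) `|p x|.
have main n : (0 < n)%N ->
    n%:R * (K a * M) - M <= n%:R * \int[lebesgue_measure]_(x in D) (K x * p x) + I.
  move=> n0; have nR : 0 < n%:R :> R by rewrite ltr0n.
  pose c (j : nat) (x : R) : R := (j.+1%:R <= n%:R * K x)%R%:R.
  have mc j : measurable_fun D (c j).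
    apply: nondecreasing_measurable => // s t st; rewrite /c ler_nat.
    case: (leP j.+1%:R (n%:R * K s)) => // js.
    by rewrite (le_trans js)// ler_wpM2l// homoK.
  have c1 j x : `|c j x| <= 1 by rewrite /c; case: (j.+1%:R <= _); rewrite ?normr1 ?normr0.
  have icp j : lebesgue_measure.-integrable D (EFin \o (fun x => c j x * p x)) by exact: ibd.
  have Kc x : `|n%:R * K x - \sum_(j < n) c j x| <= 1.
    have nK0 : 0 <= n%:R * K x by rewrite mulr_ge0.
    have [h1 h2] := count_steps n nK0.
    rewrite ger0_norm ?subr_ge0// lerBlDl; apply: h2.
    apply: (@le_lt_trans _ _ n%:R); last by rewrite ltr_nat.
    by rewrite ler_piMr.
  have level j : (j.+1%:R <= n%:R * K a)%R%:R * M <=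
      \int[lebesgue_measure]_(x in D) (c j x * p x).
    have -> : \int[lebesgue_measure]_(x in D) (c j x * p x) =
        \int[lebesgue_measure]_(x in D `&` [set x | j.+1%:R / n%:R <= K x]) p x.
      rewrite Rintegral_mkcondr; apply: eq_Rintegral => x _.
      have -> : c j x = (j.+1%:R / n%:R <= K x)%R%:R.
        by rewrite /c mulrC -ler_pdivrMr.
      rewrite patchE (_ : (x \in _) = (j.+1%:R / n%:R <= K x)).
        by case: ifP; rewrite ?mul1r ?mul0r.
      by apply/idP/idP; rewrite inE.
    rewrite mulrC (mulrC n%:R) -ler_pdivrMr//.
    have [jK|Kj] := leP (j.+1%:R / n%:R) (K a).
      by rewrite mulr1; apply: (Rintegral_upper_ge homoK ip ab).
    rewrite mulr0.
    have [[u [ub yu]]|nex] :=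
        pselect (exists u, 0 <= u <= b /\ j.+1%:R / n%:R <= K u).
      apply: (Rintegral_upper_ge homoK ip ub yu) => s /andP[s0 su].
      by apply: H0; rewrite s0 (le_trans su)//; case/andP: ub.
    rewrite (_ : D `&` _ = set0) ?Rintegral_set0//.
    apply/seteqP; split=> x //= -[]; rewrite /D/= in_itv/= => xb yx.
    by apply: nex; exists x.
  have sumge : n%:R * (K a * M) - M <= \sum_(j < n) \int[lebesgue_measure]_(x in D) (c j x * p x).
    apply: (@le_trans _ _ (\sum_(j < n) (j.+1%:R <= n%:R * K a)%R%:R * M)).
      rewrite -mulr_suml mulrA -{2}(mul1r M) -mulrBl ler_wpM2r//.
      have := Kc a; rewrite ler_norml => /andP[_ h]; rewrite /c in h; lra.
    by apply: ler_sum => j _; exact: level.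
  apply: le_trans sumge _; rewrite -(Rintegral_sum_ord _ mD icp) -RintegralZl//.
  have inKp : lebesgue_measure.-integrable D
      (EFin \o (fun x => n%:R * (K x * p x))).
    exact: (integrableZl _ n%:R iKp).
  rewrite /I -RintegralD//.
  apply: le_Rintegral => //.
  - exact: (integrable_sum_ord _ mD icp).
  - exact: (integrableD _ inKp ipn).
  - move=> x _; rewrite -mulr_suml mulrA -lerBlDl -mulrBl.
    apply: le_trans (ler_norm _) _; rewrite normrM ler_piMl//.
    by rewrite distrC.
rewrite leNgt; apply/negP => lt.
set e := K a * M - \int[lebesgue_measure]_(x in D) (K x * p x).
have e0 : 0 < e by rewrite subr_gt0.
have I0 : 0 <= I by exact: Rintegral_ge0.
have MIe : 0 <= (M + I) / e by exact: divr_ge0 (addr_ge0 M0 I0) (ltW e0).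
have [n hn] : exists n : nat, (M + I) / e < n%:R.
  by exists (Num.bound ((M + I) / e)); rewrite archi_boundP.
have n0 : (0 < n)%N.
  by rewrite -(ltr0n R); exact: le_lt_trans hn.
have := main n n0; move: hn; rewrite ltr_pdivrMr// /e mulrBr; lra.
Qed.

(** * Weak derivatives and the fundamental theorem of calculus *)

(** A two-sided quadratic bound on the remainder is stable under linear
    combinations and affine changes of variable, so that the piecewise
    polynomials below need no case analysis at their nodes. *)
Lemma is_derive_quadratic (R : realType) (f : R -> R) (x d C : R) :
  (forall y, `|f y - f x - (y - x) * d| <= C * (y - x) ^+ 2) ->
  is_derive x 1 f d.
Proof.
move=> fC.
have C0 : 0 <= C.
  have := le_trans (normr_ge0 _) (fC (x + 1)).
  by rewrite (_ : x + 1 - x = 1) ?expr1n ?mulr1//; ring.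
have h : (fun e : R => e^-1 *: ((f \o shift x) (e *: 1%R) - f x)) @ 0^' --> d.
  apply/cvgrPdist_le => e e0; near=> t.
  have t0 : t != 0 by near: t; exact: nbhs_dnbhs_neq.
  have tn : 0 < `|t| by rewrite normr_gt0.
  have -> : d - t^-1 *: ((f \o shift x) (t *: 1%R) - f x) =
      - t^-1 * (f (t + x) - f x - (t + x - x) * d).
    by rewrite /GRing.scale/= mulr1; field.
  rewrite normrM normrN normfV mulrC ler_pdivrMr//.
  apply: le_trans (fC _) _; rewrite addrK -[t ^+ 2]real_normK ?num_real//.
  rewrite expr2 mulrA ler_wpM2r//.
  apply: (@le_trans _ _ ((C + 1) * `|t|)); first by rewrite ler_wpM2r// lerDl.
  rewrite mulrC -ler_pdivlMr ?ltr_wpDl//.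
  near: t; apply: dnbhs0_le; rewrite divr_gt0// ltr_wpDl//.
split; first by apply/cvg_ex; exists d.
exact: cvg_lim h.
Unshelve. all: by end_near. Qed.

Definition sqrpos (R : realType) (x : R) : R := Num.max x 0 ^+ 2.

(** A bump supported in [[0, 2]], the derivative of [smoothstep]. *)
Definition hat (R : realType) (x : R) : R :=
  Num.max x 0 - 2 * Num.max (x - 1) 0 + Num.max (x - 2) 0.

(** A second difference of [sqrpos], hence of class C1, that increases from [0]
    on the negative half-line to [1] on [[2, +oo[]. *)
Definition smoothstep (R : realType) (x : R) : R :=
  (sqrpos x - 2 * sqrpos (x - 1) + sqrpos (x - 2)) / 2.

Lemma sqrpos_quadratic (R : realType) (a b : R) :
  `|sqrpos b - sqrpos a - 2 * (b - a) * Num.max a 0| <= (b - a) ^+ 2.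
Proof.
rewrite /sqrpos ler_norml; apply/andP.
have s0 : 0 <= (b - a) ^+ 2 by exact: sqr_ge0.
case: (leP a 0) => ha; case: (leP b 0) => hb; split.
- by lra.
- by lra.
- by nra.
- have : 0 <= - a * b by rewrite mulr_ge0 ?oppr_ge0// ltW.
  by have := sqr_ge0 a; nra.
- have : 0 <= a * - b by rewrite mulr_ge0 ?oppr_ge0// ltW.
  by have := sqr_ge0 a; nra.
- have : 0 <= a * - b by rewrite mulr_ge0 ?oppr_ge0// ltW.
  by have := sqr_ge0 b; nra.
- by nra.
- by nra.
Qed.

Lemma smoothstep_quadratic (R : realType) (a b : R) :
  `|smoothstep b - smoothstep a - (b - a) * hat a| <= 2 * (b - a) ^+ 2.
Proof.
have := sqrpos_quadratic a b.
have := sqrpos_quadratic (a - 1) (b - 1).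
have := sqrpos_quadratic (a - 2) (b - 2).
have -> : b - 1 - (a - 1) = b - a by ring.
have -> : b - 2 - (a - 2) = b - a by ring.
rewrite /smoothstep /hat.
set m0 := Num.max a 0; set m1 := Num.max _ 0; set m2 := Num.max _ 0.
rewrite !ler_norml => /andP[? ?] /andP[? ?] /andP[? ?].
by apply/andP; split; lra.
Qed.

Lemma hat_ge0 (R : realType) (x : R) : 0 <= hat x.
Proof.
rewrite /hat.
by case: (leP x 0) => ?; case: (leP (x - 1) 0) => ?; case: (leP (x - 2) 0) => ?; lra.
Qed.

Lemma hat_eq0 (R : realType) (x : R) : ~~ (0 < x < 2) -> hat x = 0.
Proof.
rewrite negb_and -!leNgt /hat => /orP[] hx.
  by case: (leP x 0) => ?; case: (leP (x - 1) 0) => ?; case: (leP (x - 2) 0) => ?; lra.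
by case: (leP x 0) => ?; case: (leP (x - 1) 0) => ?; case: (leP (x - 2) 0) => ?; lra.
Qed.

Lemma hat_continuous (R : realType) : continuous (@hat R).
Proof.
have m c : continuous (fun x : R => Num.max (x - c) 0).
  move=> x; apply: (@continuous_comp _ _ _ (fun x : R => x - c)
    (fun x => Num.max x 0)).
    by apply: cvgB; [exact: cvg_id|exact: cvg_cst].
  by apply: continuous_max; [exact: cvg_id|exact: cvg_cst].
move=> x; apply: cvgD; last exact: m.
apply: cvgB; last by apply: cvgMl_tmp; exact: m.
by apply: continuous_max; [exact: cvg_id|exact: cvg_cst].
Qed.

Lemma smoothstep_le0 (R : realType) (x : R) : x <= 0 -> smoothstep x = 0.
Proof.
move=> x0; rewrite /smoothstep /sqrpos.
by case: (leP x 0) => ?; case: (leP (x - 1) 0) => ?; case: (leP (x - 2) 0) => ?; lra.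
Qed.

Lemma smoothstep_ge2 (R : realType) (x : R) : 2 <= x -> smoothstep x = 1.
Proof.
move=> x2; rewrite /smoothstep /sqrpos.
have -> : Num.max x 0 = x by apply/max_idPl; lra.
have -> : Num.max (x - 1) 0 = x - 1 by apply/max_idPl; lra.
have -> : Num.max (x - 2) 0 = x - 2 by apply/max_idPl; lra.
by field.
Qed.

Lemma smoothstep_itv (R : realType) (x : R) : 0 <= smoothstep x <= 1.
Proof.
have [/smoothstep_le0 ->|x0] := leP x 0; first by rewrite lexx ler01.
have [/smoothstep_ge2 ->|x2] := leP 2 x; first by rewrite lexx ler01.
rewrite /smoothstep /sqrpos; apply/andP.
by case: (leP x 0) => ?; case: (leP (x - 1) 0) => ?; case: (leP (x - 2) 0) => ?; split; nra.
Qed.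

Lemma within_itv_continuous_mul_integrable (R : realType) (T : R) (z k : R -> R) :
  {within `[0, T], continuous z} -> continuous k ->
  lebesgue_measure.-integrable `[0, T] (EFin \o (fun x => z x * k x)).
Proof.
move=> cz ck; apply: continuous_compact_integrable; first exact: segment_compact.
by move=> x; apply: cvgM; [exact: cz|exact: (continuous_subspaceT ck)].
Qed.

Lemma Rintegral_approx_identity (R : realType) (T s c : R) (z : R -> R)
    (k : nat -> R -> R) : 0 <= s <= T ->
  {within `[0, T], continuous z} ->
  (forall n, continuous (k n)) -> (forall n x, 0 <= k n x) ->
  (forall n, \int[lebesgue_measure]_(x in `[0, T]) k n x = 1) ->
  (forall n x, c / n.+1%:R < `|x - s| -> k n x = 0) ->
  (fun n => \int[lebesgue_measure]_(x in `[0, T]) (z x * k n x)) @ \oo --> z s.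
Proof.
move=> sT cz ck k0 k1 ks.
have c1 : {within `[0, T], continuous (cst 1 : R -> R)}.
  by apply: continuous_subspaceT => x; exact: cvg_cst.
have ik n : lebesgue_measure.-integrable `[0, T] (EFin \o k n).
  have := within_itv_continuous_mul_integrable c1 (ck n).
  by congr (_.-integrable _ _); apply/funext => x /=; rewrite mul1r.
have izk n := within_itv_continuous_mul_integrable cz (ck n).
have Ts : `[0, T]%classic s by rewrite /= in_itv.
have /subspace_continuousP /(_ s Ts) czs := cz.
apply/cvgrPdist_le => e e0.
move/cvgrPdist_le : czs => /(_ e e0); rewrite /within/= => -[d /= d0 Hd].
have [n0 hn0] : exists n0 : nat, `|c| / d < n0%:R.
  by exists (Num.bound (`|c| / d)); rewrite archi_boundP// divr_ge0// ltW.
exists n0 => // n /= nn0.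
have cn : c / n.+1%:R < d.
  apply: (@le_lt_trans _ _ (`|c| / n.+1%:R)).
    by rewrite ler_wpM2r ?invr_ge0// ler_norm.
  rewrite ltr_pdivrMr// mulrC -ltr_pdivrMr//; apply: lt_le_trans hn0 _.
  by rewrite ler_nat leqW.
have -> : z s = \int[lebesgue_measure]_(x in `[0, T]) (z s * k n x).
  by rewrite RintegralZl// k1 mulr1.
have izsk : lebesgue_measure.-integrable `[0, T] (EFin \o (fun x => z s * k n x)).
  exact: (integrableZl _ (z s) (ik n)).
rewrite -RintegralB//.
have iB : lebesgue_measure.-integrable `[0, T]
    (EFin \o (fun x => z s * k n x - z x * k n x)).
  exact: (integrableB _ izsk (izk n)).
apply: le_trans (le_normr_Rintegral _ iB) _ => //.
have -> : e = \int[lebesgue_measure]_(x in `[0, T]) (e * k n x).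
  by rewrite RintegralZl// k1 mulr1.
apply: le_Rintegral => //.
- exact: (integrable_abse iB).
- exact: (integrableZl _ e (ik n)).
move=> x xT; rewrite -mulrBl normrM (ger0_norm (k0 n x)).
have [xs|sx] := ltP (c / n.+1%:R) `|x - s|; first by rewrite (ks _ _ xs) !mulr0.
rewrite ler_wpM2r//; apply: Hd => //=.
by rewrite distrC; exact: le_lt_trans cn.
Qed.

Lemma smoothstep_affine_derive (R : realType) (a b x : R) :
  is_derive x 1 (fun x => smoothstep (a * x + b)) (a * hat (a * x + b)).
Proof.
apply: (@is_derive_quadratic _ _ _ _ (2 * a ^+ 2)) => y.
have := smoothstep_quadratic (a * x + b) (a * y + b).
have -> : a * y + b - (a * x + b) = (y - x) * a by ring.
rewrite -mulrA (_ : 2 * ((y - x) * a) ^+ 2 = 2 * a ^+ 2 * (y - x) ^+ 2)//.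
by ring.
Qed.

Lemma smoothstep_affine_continuous (R : realType) (a b : R) :
  continuous (fun x : R => smoothstep (a * x + b)).
Proof.
move=> x; apply: differentiable_continuous; apply/derivable1_diffP.
by have [] := smoothstep_affine_derive a b x.
Qed.

Lemma hat_affine_continuous (R : realType) (a b : R) :
  continuous (fun x : R => a * hat (a * x + b)).
Proof.
move=> x; apply: cvgMl_tmp.
apply: (@continuous_comp _ _ _ (fun x : R => a * x + b)); last exact: hat_continuous.
by apply: cvgD; [apply: cvgMl_tmp; exact: cvg_id|exact: cvg_cst].
Qed.

Lemma Rintegral_hat (R : realType) (T a b : R) : 0 < T ->
  b <= 0 -> 2 <= a * T + b ->
  \int[lebesgue_measure]_(x in `[0, T]) (a * hat (a * x + b)) = 1.
Proof.
move=> T0 b0 abT; have d := @smoothstep_affine_derive _ a b.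
have c := @smoothstep_affine_continuous _ a b.
rewrite /Rintegral (@continuous_FTC2 _ _ (fun x => smoothstep (a * x + b)))//=.
- by rewrite mulr0 add0r (smoothstep_le0 b0) (smoothstep_ge2 abT) subr0.
- by apply: continuous_subspaceT; exact: hat_affine_continuous.
- split; first by move=> x _; have [] := d x.
  + by apply: cvg_at_right_filter; exact: c.
  + by apply: cvg_at_left_filter; exact: c.
- by move=> x _; rewrite derive1E; have [] := d x.
Qed.

(** The offsets are chosen so that the support lies in
    [[s + 1 / N, t - 1 / N]], which stays inside an open interval having [s] or
    [t] as an endpoint, while the function is [1] on [[s + 3 / N, t - 3 / N]]. *)
Definition plateau (R : realType) (s t N x : R) : R :=
  smoothstep (N * x + (- (N * s) - 1)) - smoothstep (N * x + (3 - N * t)).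

Lemma plateau_derive (R : realType) (s t N x : R) :
  is_derive x 1 (plateau s t N)
    (N * hat (N * x + (- (N * s) - 1)) - N * hat (N * x + (3 - N * t))).
Proof. by apply: is_deriveB; exact: smoothstep_affine_derive. Qed.

Lemma plateau_derive1 (R : realType) (s t N : R) :
  derive1 (plateau s t N) = (fun x =>
    N * hat (N * x + (- (N * s) - 1)) - N * hat (N * x + (3 - N * t))).
Proof.
by apply/funext => x; rewrite derive1E; have [] := plateau_derive s t N x.
Qed.

Lemma plateau_norm_le1 (R : realType) (s t N x : R) : `|plateau s t N x| <= 1.
Proof.
rewrite /plateau.
have /andP[? ?] := smoothstep_itv (N * x + (- (N * s) - 1)).
have /andP[? ?] := smoothstep_itv (N * x + (3 - N * t)).
by rewrite ler_norml; apply/andP; split; lra.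
Qed.

Lemma plateau_left (R : realType) (s t N x : R) : 0 < N -> 4 <= N * (t - s) ->
  N * (x - s) <= 1 -> plateau s t N x = 0.
Proof.
move=> N0; rewrite !mulrBr => h1 h2.
by rewrite /plateau !smoothstep_le0 ?subrr//; lra.
Qed.

Lemma plateau_right (R : realType) (s t N x : R) : 0 < N -> 4 <= N * (t - s) ->
  N * (t - x) <= 1 -> plateau s t N x = 0.
Proof.
move=> N0; rewrite !mulrBr => h1 h2.
by rewrite /plateau !smoothstep_ge2 ?subrr//; lra.
Qed.

Lemma plateau_mid (R : realType) (s t N x : R) :
  3 <= N * (x - s) -> 3 <= N * (t - x) -> plateau s t N x = 1.
Proof.
rewrite !mulrBr => h1 h2; rewrite /plateau.
by rewrite smoothstep_ge2 ?smoothstep_le0 ?subr0//; lra.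
Qed.

Lemma plateau_test (R : realType) (T s t N : R) : 0 <= s -> t <= T -> 0 < N ->
  4 <= N * (t - s) -> is_test_function T (plateau s t N).
Proof.
move=> s0 tT N0 Nts; split.
- by move=> x; have [] := plateau_derive s t N x.
- rewrite plateau_derive1 => x.
  by apply: cvgB; exact: hat_affine_continuous.
- exists `[s + N^-1, t - N^-1]%classic; split.
  + exact: segment_compact.
  + move=> x /=; rewrite !in_itv/= => /andP[sx xt].
    have : 0 < N^-1 by rewrite invr_gt0.
    by move=> ?; apply/andP; split; lra.
  + move=> x /= /negP; rewrite in_itv/= negb_and -!ltNge => /orP[h|h].
      apply: plateau_left => //.
      by rewrite mulrC -ler_pdivlMr// mul1r lerBlDl ltW.
    apply: plateau_right => //.
    by rewrite mulrC -ler_pdivlMr// mul1r lerBlDr -lerBlDl ltW.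
Qed.

Lemma Rintegral_itvoo_itvcc (R : realType) (a b : R) (h : R -> R) :
  lebesgue_measure.-integrable `[a, b] (EFin \o h) ->
  \int[lebesgue_measure]_(x in `]a, b[) h x =
  \int[lebesgue_measure]_(x in `[a, b]) h x.
Proof.
move=> ih; rewrite Rintegral_itv_bndo_bndc; last first.
  by apply: integrableS ih => //; exact: subset_itv_oo_cc.
rewrite Rintegral_itv_obnd_cbnd//.
by apply: integrableS ih => //; exact: subset_itv_oc_cc.
Qed.

(** Testing against [plateau s t N] and letting [N] grow: its derivative is the
    difference of two approximate identities, at [s] and at [t], and the
    function itself tends to the indicator of [`]s, t[]. *)
Lemma weak_derivative_FTC (R : realType) (T : R) (z p : R -> R) (s t : R) :
  0 < T -> {within `[0, T], continuous z} ->
  lebesgue_measure.-integrable `[0, T] (EFin \o p) ->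
  is_weak_derivative T z p -> 0 <= s -> s <= t -> t <= T ->
  \int[lebesgue_measure]_(x in `[s, t]) p x = z t - z s.
Proof.
move=> T0 cz ip wp s0; rewrite le_eqVlt => /predU1P[<- _|st tT].
  by rewrite set_itv1 Rintegral_set1 subrr.
(* The shift makes [plateau s t (N n)] a test function for every [n]. *)
pose N n : R := n.+1%:R + 4 / (t - s).
have ts0 : 0 < t - s by rewrite subr_gt0.
have Nn n : n.+1%:R <= N n by rewrite lerDl divr_ge0// ltW.
have N0 n : 0 < N n by exact: lt_le_trans (Nn n).
have Nts n : 4 <= N n * (t - s).
  by rewrite -ler_pdivrMr// lerDr.
pose phi n := plateau s t (N n).
have tphi n : is_test_function T (phi n) by exact: plateau_test.
have near c x n : 0 < N n * (x - c) + 3 < 6 -> `|x - c| <= 3 / n.+1%:R.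
  move=> /andP[h1 h2]; apply: (@le_trans _ _ (3 / N n)).
    rewrite ler_pdivlMr// -{1}(gtr0_norm (N0 n)) -normrM ler_norml mulrC.
    by apply/andP; split; lra.
  by rewrite ler_wpM2l// lef_pV2 ?posrE.
have as_ : (fun n => \int[lebesgue_measure]_(x in `[0, T])
    (z x * (N n * hat (N n * x + (- (N n * s) - 1))))) @ \oo --> z s.
  apply: (@Rintegral_approx_identity _ T s 3) => //.
  - by rewrite s0 (le_trans (ltW st)).
  - by move=> n; exact: hat_affine_continuous.
  - by move=> n x; rewrite mulr_ge0 ?hat_ge0// ltW.
  - move=> n; apply: Rintegral_hat => //.
      have : 0 <= N n * s by rewrite mulr_ge0// ltW.
      by lra.
    have := Nts n; have : N n * t <= N n * T by rewrite ler_pM2l.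
    by rewrite mulrBr; lra.
  - move=> n x; rewrite ltNge => h; rewrite hat_eq0 ?mulr0//.
    apply: contra h => /andP[h1 h2]; apply: near; rewrite mulrBr.
    by apply/andP; split; lra.
have at_ : (fun n => \int[lebesgue_measure]_(x in `[0, T])
    (z x * (N n * hat (N n * x + (3 - N n * t))))) @ \oo --> z t.
  apply: (@Rintegral_approx_identity _ T t 3) => //.
  - by rewrite tT (le_trans s0 (ltW st)).
  - by move=> n; exact: hat_affine_continuous.
  - by move=> n x; rewrite mulr_ge0 ?hat_ge0// ltW.
  - move=> n; apply: Rintegral_hat => //.
      have := Nts n; have : 0 <= N n * s by rewrite mulr_ge0// ltW.
      by rewrite mulrBr; lra.
    have : N n * t <= N n * T by rewrite ler_pM2l.
    by lra.
  - move=> n x; rewrite ltNge => h; rewrite hat_eq0 ?mulr0//.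
    apply: contra h => /andP[h1 h2]; apply: near; rewrite mulrBr.
    by apply/andP; split; lra.
have mD : measurable (`[0, T]%classic : set R) by exact: measurable_itv.
have mp : measurable_fun `[0, T] p.
  by apply/measurable_EFinP; exact: (measurable_int _ ip).
have mphi n : measurable_fun `[0, T] (phi n).
  apply: measurable_funB; apply: measurable_funTS;
  by apply: continuous_measurable_fun; exact: smoothstep_affine_continuous.
have ipn : lebesgue_measure.-integrable `[0, T] (EFin \o (fun x => `|p x|)).
  exact: (integrable_abse ip).
have bnd n x : `[0, T]%classic x -> `|p x * phi n x| <= `|p x|.
  by move=> _; rewrite normrM ler_piMr// plateau_norm_le1.
have ipphi n : lebesgue_measure.-integrable `[0, T] (EFin \o (fun x => p x * phi n x)).
  apply: le_integrable ipn => //.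
    by apply/measurable_EFinP; apply: measurable_funM; [exact: mp|exact: mphi].
  by move=> x xT; rewrite /= lee_fin normr_id bnd.
have [|||_ cp] := @Rintegral_dominated_cvg _ _ _ lebesgue_measure `[0, T]%classic
    (fun n x => p x * phi n x) (p \_ `]s, t[) (fun x => `|p x|) mD _ _ ipn.
- by move=> n; apply: measurable_funM; [exact: mp|exact: mphi].
- move=> x _; rewrite patchE; case: ifPn.
    rewrite inE/= in_itv/= => /andP[sx xt].
    have c : (fun=> p x) @ \oo --> p x by exact: cvg_cst.
    apply: cvg_trans c; apply: near_eq_cvg.
    have [n1 hn1] : exists n1 : nat, 3 / (x - s) < n1%:R.
      by exists (Num.bound (3 / (x - s))); rewrite archi_boundP// divr_ge0 ?subr_ge0// ltW.
    have [n2 hn2] : exists n2 : nat, 3 / (t - x) < n2%:R.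
      by exists (Num.bound (3 / (t - x))); rewrite archi_boundP// divr_ge0 ?subr_ge0// ltW.
    exists (maxn n1 n2) => // n /=; rewrite geq_max => /andP[n1n n2n].
    have big m : (m <= n)%N -> m%:R <= N n.
      by move=> mn; apply: le_trans (Nn n); rewrite ler_nat leqW.
    rewrite /phi plateau_mid ?mulr1// -ler_pdivrMr ?subr_gt0//.
      exact: le_trans (ltW hn1) (big _ _).
    exact: le_trans (ltW hn2) (big _ _).
  rewrite notin_setE/= in_itv/= => /negP; rewrite negb_and -!leNgt => xst.
  suff h n : p x * phi n x = 0.
    by under eq_fun do rewrite h; exact: cvg_cst.
  case/orP: xst => h; rewrite /phi.
    rewrite plateau_left ?mulr0// (le_trans _ ler01)//.
    by rewrite mulr_ge0_le0 ?subr_le0// ltW.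
  rewrite plateau_right ?mulr0// (le_trans _ ler01)//.
  by rewrite mulr_ge0_le0 ?subr_le0// ltW.
- by [].
have e n : \int[lebesgue_measure]_(x in `[0, T]) (p x * phi n x) =
    \int[lebesgue_measure]_(x in `[0, T])
      (z x * (N n * hat (N n * x + (3 - N n * t)))) -
    \int[lebesgue_measure]_(x in `[0, T])
      (z x * (N n * hat (N n * x + (- (N n * s) - 1)))).
  have := wp _ (tphi n); rewrite !Rintegral_itvoo_itvcc//; last first.
    apply: within_itv_continuous_mul_integrable => //.
    by have [] := tphi n.
  have i1 := within_itv_continuous_mul_integrable cz
    (@hat_affine_continuous _ (N n) (- (N n * s) - 1)).
  have i2 := within_itv_continuous_mul_integrable cz
    (@hat_affine_continuous _ (N n) (3 - N n * t)).
  rewrite -RintegralB// => /eqP; rewrite eq_sym eqr_oppLR => /eqP ->.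
  rewrite plateau_derive1 -[RHS]opprK; congr (- _).
  rewrite RintegralB// opprB -RintegralB//.
  by apply: eq_Rintegral => x _; rewrite mulrBr.
have : (fun n => \int[lebesgue_measure]_(x in `[0, T]) (p x * phi n x)) @ \oo -->
    z t - z s.
  by under eq_fun do rewrite e; apply: cvgB.
move/(cvg_unique _ cp) => <- //.
rewrite -Rintegral_mkcondr.
have -> : `[0, T] `&` `]s, t[ = `]s, t[%classic.
  apply/setIidPr => x /=; rewrite !in_itv/= => /andP[sx xt].
  by rewrite (le_trans s0 (ltW sx)) (le_trans (ltW xt) tT).
rewrite Rintegral_itvoo_itvcc//; apply: integrableS ip => // x /=.
by rewrite !in_itv/= => /andP[sx xt]; rewrite (le_trans s0 sx) (le_trans xt tT).
Qed.

Lemma integrable_itvoo_itvcc (R : realType) (a b : R) (h : R -> R) :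
  lebesgue_measure.-integrable `]a, b[ (EFin \o h) ->
  lebesgue_measure.-integrable `[a, b] (EFin \o h).
Proof.
move=> /integrableP[mh ih].
have mc := emeasurable_fun_itv_cc mh; apply/integrableP; split => //.
rewrite -integral_itv_obnd_cbnd; last first.
  apply: measurableT_comp => //.
  by apply: measurable_funS mc => //; exact: subset_itv_oc_cc.
rewrite -integral_itv_bndo_bndc//.
by apply: measurableT_comp.
Qed.

(** On a bounded interval [`|u|] is at most [1 + u ^+ 2]. *)
Lemma L2_integrable (R : realType) (T : R) (u : R -> R) :
  L2 T u -> lebesgue_measure.-integrable `[0, T] (EFin \o u).
Proof.
move=> L2u; apply: integrable_itvoo_itvcc.
have mu2 : measurable_fun setT (u \_ `]0, T[).
  by move: L2u; rewrite /L2 inE => /andP[]; rewrite inE.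
have mu : measurable_fun `]0, T[ u by apply/measurable_restrictT.
have i2 : lebesgue_measure.-integrable `]0, T[
    (EFin \o (fun x => (u \_ `]0, T[) x ^+ 2)).
  by apply: integrableS (Lfun2_integrable_sqr L2u).
have i1 : lebesgue_measure.-integrable `]0, T[ (EFin \o (fun=> 1 : R)).
  have i1 : lebesgue_measure.-integrable `[0, T] (EFin \o (fun=> 1 : R)).
    apply: continuous_compact_integrable; first exact: segment_compact.
    by apply: continuous_subspaceT => x; exact: cvg_cst.
  by apply: integrableS i1 => //; exact: subset_itv_oo_cc.
have i12 : lebesgue_measure.-integrable `]0, T[
    (EFin \o (fun x => 1 + (u \_ `]0, T[) x ^+ 2)).
  exact: (integrableD _ i1 i2).
apply: le_integrable i12 => //; first exact/measurable_EFinP.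
move=> x xT /=; rewrite lee_fin patchE mem_set//.
rewrite [leRHS]ger0_norm ?addr_ge0 ?sqr_ge0//.
rewrite -[u x ^+ 2]real_normK ?num_real//.
by have := sqr_ge0 (`|u x| - 1); have := normr_ge0 (u x); nra.
Qed.

Lemma weak_derivativeP (R : realType) (T : R) (x : R -> R) : H1 T x ->
  L2 T (weak_derivative T x) /\ is_weak_derivative T x (weak_derivative T x).
Proof. by move=> [_ ex]; exact: (xgetPex (fun=> 0) ex). Qed.

(** * Comparison for the ABC derivative *)

(** Where [F > G] at one point, continuity gives [F > G] on an interval of
    positive length. *)
Lemma le_within_ae (R : realType) (T : R) (F G : R -> R) : 0 < T ->
  {within `[0, T], continuous F} -> {within `[0, T], continuous G} ->
  {ae lebesgue_measure, forall t : R, t \in `[0, T] -> F t <= G t} ->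
  forall t : R, t \in `[0, T] -> F t <= G t.
Proof.
move=> T0 cF cG [N [mN N0 Nsub]] t tT; rewrite leNgt; apply/negP => GF.
have Tt : `[0, T]%classic t by [].
have /subspace_continuousP /(_ t Tt) cFt := cF.
have /subspace_continuousP /(_ t Tt) cGt := cG.
have e0 : 0 < (F t - G t) / 2 by rewrite divr_gt0// subr_gt0.
move/cvgrPdist_lt : cFt => /(_ _ e0); rewrite /within/= => -[d /= d0 Hd].
move/cvgrPdist_lt : cGt => /(_ _ e0); rewrite /within/= => -[d' /= d'0 Hd'].
have /andP[t0 tT'] : 0 <= t <= T by move: tT; rewrite in_itv.
have [r [r0 rd rd']] : exists r, [/\ 0 < r, r <= d & r <= d'].
  by exists (Num.min d d'); rewrite lt_min d0 d'0 !ge_min !lexx orbT.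
pose a := Num.max 0 (t - r); pose b := Num.min T (t + r).
have ab : a < b.
  by rewrite /a /b lt_min !gt_max T0/=; apply/and3P; split; lra.
have abN : `]a, b[ `<=` N.
  move=> x /=; rewrite in_itv/= /a /b gt_max lt_min.
  move=> /andP[/andP[x0 tx] /andP[xT xt]]; apply: Nsub => /= H.
  have xT' : x \in `[0, T] by rewrite in_itv/= !ltW.
  have xr : `|t - x| < r by rewrite ltr_norml; apply/andP; split; lra.
  have h1 := Hd x (lt_le_trans xr rd) xT'.
  have h2 := Hd' x (lt_le_trans xr rd') xT'; have h3 := H xT'.
  move: h1 h2; rewrite /from_subspace !ltr_norml => /andP[? ?] /andP[? ?].
  by lra.
have : @lebesgue_measure R `]a, b[%classic = 0%E.
  by apply: (subset_measure0 _ mN abN).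
rewrite lebesgue_measure_itv/= lte_fin ab -EFinB => -[] /eqP.
by rewrite subr_eq0 gt_eqF.
Qed.

Lemma within_itv_comp2 (R : realType) (T : R) (F : R -> R -> R) (v : R -> R) :
  {within `[0, T] `*` setT, continuous (fun q : R * R => F q.1 q.2)} ->
  {within `[0, T], continuous v} ->
  {within `[0, T], continuous (fun t => F t (v t))}.
Proof.
move=> /subspace_continuousP cF /subspace_continuousP cv.
apply/subspace_continuousP => t tT.
have Tt : (`[0, T] `*` setT)%classic (t, v t) by [].
have pc : (fun s => (s, v s)) @ within `[0, T] (nbhs t) -->
    nbhs (t, v t).
  have idc : id @ within `[0, T] (nbhs t) --> nbhs t by exact: cvg_within.
  exact: (cvg_pair idc (cv t tT)).
have pw : (fun s => (s, v s)) @ within `[0, T] (nbhs t) -->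
    within (`[0, T] `*` setT) (nbhs (t, v t)).
  move=> U /pc; apply: (@filterS _ (nbhs t) (nbhs_filter t)) => s H sT.
  exact: H.
apply: (@cvg_comp _ _ _ (fun s => (s, v s)) (fun q => F q.1 q.2) _ _ _ pw).
exact: (cF (t, v t) Tt).
Qed.

(** The truncation [Num.max _ 0] is inactive on [`[0, tau]]; it makes the kernel
    monotone on the whole line. *)
Definition ABC_kernel (R : realType) (al tau s : R) : R :=
  mittag_leffler al (- (al / (1 - al) * Num.max (tau - s) 0 `^ al)).

Lemma ABC_kernel_nondecreasing (R : realType) (al tau : R) : 0 < al < 1 ->
  {homo ABC_kernel al tau : s t / s <= t}.
Proof.
move=> /andP[al0 al1] s t st.
have la0 : 0 <= al / (1 - al) by rewrite divr_ge0 ?subr_ge0 ?ltW.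
apply: mittag_leffler_nonincreasing; first by rewrite al0 ltW.
rewrite mulr_ge0 ?powR_ge0//= ler_wpM2l//.
have max_ge0 u : 0 <= Num.max u 0 :> R by rewrite le_max lexx orbT.
apply: ge0_ler_powR; rewrite ?nnegrE ?(ltW al0)//.
by rewrite ge_max !le_max lexx orbT andbT lerD2l lerN2 st.
Qed.

Lemma ABC_kernel_itv (R : realType) (al tau s : R) : 0 < al < 1 ->
  0 <= ABC_kernel al tau s <= 1.
Proof.
move=> /andP[al0 al1].
have al01 : 0 < al <= 1 by rewrite al0 ltW.
have la0 : 0 <= al / (1 - al) by rewrite divr_ge0 ?subr_ge0 ?ltW.
have x0 : 0 <= al / (1 - al) * Num.max (tau - s) 0 `^ al.
  by rewrite mulr_ge0 ?powR_ge0.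
rewrite mittag_leffler_ge0//= -(mittag_leffler0 al) -oppr0.
by apply: mittag_leffler_nonincreasing => //; rewrite lexx.
Qed.

Lemma ABCE (R : realType) (B : R -> R) (al T tau : R) (x : R -> R) :
  ABC B al T x tau = B al / (1 - al) * \int[lebesgue_measure]_(s in `[0, tau])
    (ABC_kernel al tau s * weak_derivative T x s).
Proof.
rewrite /ABC; congr (_ * _); apply: eq_Rintegral => s.
rewrite inE/= in_itv/= => /andP[_ st]; rewrite /ABC_kernel mulNr.
by rewrite (max_idPl _)// subr_ge0.
Qed.

(** [Rintegral_nondecreasing_ge] applied to the weak derivative of [x - y], whose
    integral over [[s, tau]] is [(x tau - y tau) - (x s - y s)]. *)
Lemma ABC_sub_ge (R : realType) (B : R -> R) (al T : R) (x y : R -> R)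
    (a tau : R) : 0 < al < 1 -> 0 <= B al -> 0 < T ->
  {within `[0, T], continuous x} -> {within `[0, T], continuous y} ->
  H1 T x -> H1 T y -> 0 <= a <= tau -> tau <= T ->
  (forall s, 0 <= s <= a -> x s <= y s) ->
  (forall s, 0 <= s <= tau -> x s - y s <= x tau - y tau) ->
  y tau <= x tau ->
  B al / (1 - al) * (ABC_kernel al tau a * (x tau - y tau)) <=
    ABC B al T x tau - ABC B al T y tau.
Proof.
move=> al01 B0 T0 cx cy hx hy /andP[a0 at_] tT xya maxt yx.
have /andP[al0 al1] := al01; have tau0 := le_trans a0 at_.
have [L2p wp] := weak_derivativeP hx; have [L2q wq] := weak_derivativeP hy.
set p := weak_derivative T x in L2p wp *.
set q := weak_derivative T y in L2q wq *.
have ip := L2_integrable L2p; have iq := L2_integrable L2q.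
have sub s t : 0 <= s -> t <= T -> `[s, t] `<=` `[0, T].
  move=> s0 tT' u /=; rewrite !in_itv/= => /andP[su ut].
  by rewrite (le_trans s0 su) (le_trans ut tT').
have ips s t : 0 <= s -> t <= T ->
    lebesgue_measure.-integrable `[s, t] (EFin \o p).
  by move=> s0 tT'; apply: integrableS ip => //; exact: sub.
have iqs s t : 0 <= s -> t <= T ->
    lebesgue_measure.-integrable `[s, t] (EFin \o q).
  by move=> s0 tT'; apply: integrableS iq => //; exact: sub.
have ftc s : 0 <= s <= tau ->
    \int[lebesgue_measure]_(u in `[s, tau]) (p u - q u) =
    (x tau - y tau) - (x s - y s).
  move=> /andP[s0 st]; rewrite RintegralB//; [|exact: ips|exact: iqs].
  rewrite (weak_derivative_FTC T0 cx ip wp s0 st tT).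
  by rewrite (weak_derivative_FTC T0 cy iq wq s0 st tT); ring.
have ipq : lebesgue_measure.-integrable `[0, tau]
    (EFin \o (fun u => p u - q u)).
  exact: (integrableB _ (ips _ _ (lexx 0) tT) (iqs _ _ (lexx 0) tT)).
have ik r : lebesgue_measure.-integrable `[0, tau] (EFin \o r) ->
    lebesgue_measure.-integrable `[0, tau]
      (EFin \o (fun u => ABC_kernel al tau u * r u)).
  move=> ir; have mr : measurable_fun `[0, tau] r.
    by apply/measurable_EFinP; exact: (measurable_int _ ir).
  apply: le_integrable ir => //.
    apply/measurable_EFinP; apply: measurable_funM => //.
    by apply: nondecreasing_measurable => //; exact: ABC_kernel_nondecreasing.
  move=> u _; rewrite /= lee_fin normrM ler_piMl//.
  by have /andP[k0 k1] := ABC_kernel_itv tau u al01; rewrite ger0_norm.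
rewrite !ABCE -mulrBr ler_wpM2l ?divr_ge0 ?subr_ge0 ?(ltW al1)//.
rewrite -RintegralB//; [|exact/ik/ips|exact/ik/iqs].
under eq_Rintegral do rewrite -mulrBr.
apply: (@Rintegral_nondecreasing_ge _ (ABC_kernel al tau)
  (fun u => p u - q u)) => //.
- exact: ABC_kernel_nondecreasing.
- by move=> s; exact: ABC_kernel_itv.
- by rewrite a0.
- by rewrite subr_ge0.
- by move=> s st; rewrite ftc// subr_ge0 maxt.
- move=> s /andP[s0 sa]; rewrite ftc ?s0 ?(le_trans sa)// lerDl oppr_ge0.
  by rewrite subr_le0 xya// s0.
Qed.

Theorem theorem4p2 (R : realType) (B : R -> R) (hB : is_normalization B)
  (T : R) (hT : 0 < T) (alpha : R) (halpha0 : 0 < alpha) (halpha1 : alpha < 1)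
  (f g : R -> R -> R)
  (hf : {within `[0, T] `*` setT, continuous (fun p : R * R => f p.1 p.2)})
  (hf0 : forall t x : R, t \in `[0, T] -> f t x != 0)
  (hg : {within `[0, T] `*` setT, continuous (fun p : R * R => g p.1 p.2)})
  (hmono : forall t : R, t \in `[0, T] ->
     forall x y : R, x < y -> x / f t x < y / f t y)
  (v w : R -> R)
  (hv : {within `[0, T], continuous v})
  (hw : {within `[0, T], continuous w})
  (hvH1 : H1 T (fun t => v t / f t (v t)))
  (hwH1 : H1 T (fun t => w t / f t (w t)))
  (hvABC : {within `[0, T],
     continuous (ABC B alpha T (fun t => v t / f t (v t)))})
  (hwABC : {within `[0, T],
     continuous (ABC B alpha T (fun t => w t / f t (w t)))})
  (hi : {ae lebesgue_measure, forall t : R, t \in `[0, T] ->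
     ABC B alpha T (fun s => v s / f s (v s)) t <= g t (v t)})
  (hii : {ae lebesgue_measure, forall t : R, t \in `[0, T] ->
     g t (w t) <= ABC B alpha T (fun s => w s / f s (w s)) t})
  (L : R) (hL0 : 0 < L) (hL1 : L < B alpha / (1 - alpha))
  (hL : forall t x y : R, t \in `[0, T] -> y <= x ->
     g t x - g t y <= L * (x / f t x - y / f t y))
  (h0 : v 0 <= w 0) :
  forall t : R, t \in `[0, T] -> v t <= w t.
Proof.
have al01 : 0 < alpha < 1 by rewrite halpha0.
have al01' : 0 < alpha <= 1 by rewrite halpha0 ltW.
have oneal : 0 < 1 - alpha by rewrite subr_gt0.
have B0 : 0 < B alpha.
  by case: hB => + _ _; apply; rewrite in_itv/= !ltW.
set x := fun t => v t / f t (v t) in hvH1 hvABC hi *.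
set y := fun t => w t / f t (w t) in hwH1 hwABC hii *.
have quot_continuous (u : R -> R) : {within `[0, T], continuous u} ->
    {within `[0, T], continuous (fun t => u t / f t (u t))}.
  move=> cu; have cf := within_itv_comp2 hf cu.
  apply/subspace_continuousP => t tT.
  move/subspace_continuousP : cu => /(_ t tT) cu.
  move/subspace_continuousP : cf => /(_ t tT) cf.
  by apply: cvgM => //; apply: cvgV => //; exact: hf0.
have cx : {within `[0, T], continuous x} by exact: quot_continuous.
have cy : {within `[0, T], continuous y} by exact: quot_continuous.
have Dv := le_within_ae hT hvABC (within_itv_comp2 hg hv) hi.
have Dw := le_within_ae hT (within_itv_comp2 hg hw) hwABC hii.
have quot_le t : t \in `[0, T] -> (x t <= y t) = (v t <= w t).
  move=> tT; apply/idP/idP; last first.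
    by rewrite le_eqVlt => /predU1P[e|/(hmono t tT)/ltW//]; rewrite /x /y e.
  by rewrite !leNgt; apply: contra; exact: hmono.
pose c := B alpha / (1 - alpha).
have c0 : 0 < c by rewrite divr_gt0.
have Lc : L / c < 1 by rewrite ltr_pdivrMr// mul1r.
have [d d0 Hd] := mittag_leffler_near0 al01' Lc.
pose la := alpha / (1 - alpha); have la0 : 0 < la by rewrite divr_gt0.
(* The step length solves [la * delta `^ alpha = d]. *)
pose delta := (d / la) `^ alpha^-1.
have delta0 : 0 < delta by rewrite powR_gt0// divr_gt0.
have kernel_gt a tau : 0 <= tau - a <= delta -> L / c < ABC_kernel alpha tau a.
  move=> /andP[h1 h2]; apply: Hd; rewrite mulr_ge0 ?powR_ge0 ?(ltW la0)//=.
  rewrite mulrC -ler_pdivlMr// (max_idPl h1).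
  have -> : d / la = delta `^ alpha.
    by rewrite -powRrM mulVf ?gt_eqF// powRr1// divr_ge0// ltW.
  by apply: ge0_ler_powR; rewrite ?nnegrE// ltW.
suff main n t : t \in `[0, T] -> t <= n%:R * delta -> x t <= y t.
  move=> t tT; rewrite -quot_le//.
  have [n hn] : exists n : nat, `|t| / delta < n%:R.
    by exists (Num.bound (`|t| / delta)); rewrite archi_boundP// divr_ge0// ltW.
  apply: (main n) => //; apply: le_trans (ler_norm t) _.
  by rewrite -ler_pdivrMr// ltW.
elim: n t => [|n IH] t tT tn.
  have -> : t = 0.
    apply/eqP; rewrite eq_le; move: tn; rewrite mul0r => ->.
    by move: tT; rewrite in_itv/= => /andP[].
  by rewrite quot_le// in_itv/= lexx ltW.
have [|nt] := leP t (n%:R * delta); first exact: IH.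
have /andP[t0 tT'] : 0 <= t <= T by move: tT; rewrite in_itv.
have subT s : 0 <= s <= t -> s \in `[0, T].
  by move=> /andP[s0 st]; rewrite in_itv/= s0 (le_trans st).
have cz : {within `[0, t], continuous (fun s => x s - y s)}.
  apply: (@continuous_subspaceW _ _ _ `[0, T]).
    by move=> s /=; rewrite in_itv/=; exact: subT.
  by move=> s; apply: cvgB; [exact: cx|exact: cy].
(* A positive maximum of [x - y] over [`[0, t]] would lie beyond
   [n%:R * delta], within [delta] of the interval where [x <= y]. *)
have [tau taut Hmax] := EVT_max t0 cz.
have tau_t : 0 <= tau <= t by move: taut; rewrite in_itv.
have tauT := subT _ tau_t.
have [xy|yx] := leP (x tau) (y tau).
  rewrite -subr_le0; apply: le_trans (Hmax t _) _; last by rewrite subr_le0.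
  by rewrite in_itv/= t0 lexx.
have ntau : n%:R * delta < tau.
  by rewrite ltNge; apply: contraL yx => /(IH _ tauT); rewrite leNgt.
have /andP[tau0 taut'] := tau_t.
have nd0 : 0 <= n%:R * delta by rewrite mulr_ge0// ltW.
have vw : w tau <= v tau.
  by rewrite ltW// ltNge -quot_le// -ltNge.
have lower : c * (ABC_kernel alpha tau (n%:R * delta) * (x tau - y tau)) <=
    ABC B alpha T x tau - ABC B alpha T y tau.
  apply: ABC_sub_ge => //; rewrite ?(ltW B0) ?(ltW yx) ?nd0 ?(ltW ntau)//.
  - exact: le_trans tT'.
  - move=> s /andP[s0 sn]; apply: IH => //; apply: subT.
    by rewrite s0 (le_trans sn)// (le_trans (ltW ntau)).
  - move=> s /andP[s0 st]; apply: Hmax.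
    by rewrite in_itv/= s0 (le_trans st).
have upper : ABC B alpha T x tau - ABC B alpha T y tau <= L * (x tau - y tau).
  by apply: le_trans (lerB (Dv _ tauT) (Dw _ tauT)) _; exact: hL.
have := le_trans lower upper; rewrite mulrA ler_pM2r ?subr_gt0// leNgt.
rewrite mulrC -ltr_pdivrMr// kernel_gt// subr_ge0 (ltW ntau)/=.
by rewrite lerBlDl (le_trans taut')// (le_trans tn)// -natr1 mulrDl mul1r.
Qed.
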